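(* There exists a weakly locally finite division ring $D$ with center $F$ such that $\operatorname{GKdim}_F D=1$ and $D$ is not algebraic over $F$.
   Context: A division ring $D$ is weakly locally finite if for every finite subset $S\subseteq D$, the division subring of $D$ generated by $S$ is finite dimensional over its own center. For an algebra $A$ over a field $k$, $\operatorname{GKdim}_k(A)=\sup_V \limsup_{r\to\infty}\log_r \dim_k V^r$, where $V$ ranges over finite dimensional subspaces of $A$ containing $1$ with $\sum_{r\ge1}V^r=A$, and $V^r$ is the span of all products of $r$ elements of $V$. A division ring is algebraic over its center $F$ if each element is a root of a nonzero polynomial with coefficients in $F$.
   Formalization: GKdim is taken as the supremum over all finite dimensional subspaces V containing 1, without requiring the powers of V to sum to the whole algebra; with that requirement no such V exists for a non-algebraic weakly locally finite D, so the supremum would be over an empty family. *)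

(* Defs.v *)
From HB Require Import structures.
From mathcomp Require Import all_boot all_order all_algebra.
From mathcomp Require Import boolp classical_sets reals constructive_ereal ereal sequences exp.
From mathcomp Require Import Rstruct.

Set Implicit Arguments.
Unset Strict Implicit.
Unset Printing Implicit Defensive.

Import Order.TTheory GRing.Theory Num.Theory.
Local Open Scope classical_set_scope.
Local Open Scope ring_scope.

Section DivisionRings.
Variable D : unitRingType.

(** D is a division ring: every nonzero element is invertible
    (a unitRingType is nontrivial, 1 != 0). *)
Definition is_division_ring : Prop := forall x : D, x != 0 -> x \is a GRing.unit.

Definition center : set D := [set z | forall y : D, z * y = y * z].

Definition lincomb (K A : set D) : set D :=
  [set x | exists s : seq (D * D),
      (forall p, p \in s -> K p.1 /\ A p.2) /\ x = \sum_(p <- s) p.1 * p.2].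

Definition spanF (s : seq D) : set D := lincomb center [set x | x \in s].

Definition powV (V : set D) (r : nat) : set D :=
  lincomb center [set x | exists xs : seq D,
      size xs = r /\ (forall y, y \in xs -> V y) /\ x = \prod_(y <- xs) y].

Definition is_divsubring (B : set D) : Prop :=
  B 1 /\ (forall x y, B x -> B y -> B (x - y)) /\ (forall x y, B x -> B y -> B (x * y))
  /\ (forall x, B x -> x != 0 -> B x^-1).

Definition divsub_gen (S : set D) : set D :=
  [set x | forall B, is_divsubring B -> S `<=` B -> B x].

Definition center_of (E : set D) : set D :=
  [set z | E z /\ forall y, E y -> z * y = y * z].

Definition findim_over_own_center (E : set D) : Prop :=
  exists s : seq D, lincomb (center_of E) [set x | x \in s] = E.

Definition weakly_locally_finite : Prop :=
  forall s : seq D, findim_over_own_center (divsub_gen [set x | x \in s]).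

Definition algebraic_over_center : Prop :=
  forall x : D, exists p : {poly D},
    p != 0 /\ (forall i, center p`_i) /\ p.[x] = 0.

Section GK.
Variable R : realType.
Local Open Scope ereal_scope.

(** dim_F of a subspace W: least size of an F-spanning list (+oo if none). *)
Definition dimF (W : set D) : \bar R :=
  ereal_inf [set ((size s)%:R)%:E | s in [set s : seq D | spanF s = W]].

Definition growth (V : set D) : \bar R :=
  limn_esup (fun r : nat => ((ln (fine (dimF (powV V r))) / ln (r%:R))%R)%:E).

Definition GKdimF : \bar R :=
  ereal_sup [set growth V | V in [set V : set D | (exists s, spanF s = V) /\ V 1%R]].
End GK.

End DivisionRings.

(* Main.v *)
(** Let [L] be an algebraic closure of [F_2] and [D = L(t; s)] the division ring of
    skew rational functions, [s] being the Frobenius automorphism: [t x = x^2 t].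

    Every nonzero skew polynomial has a left multiple [t^j (t^k - 1)], because modulo it
    the powers of [t] have finitely many remainders.  So [D] consists of the [T] such that
    some [t^j (t^k - 1) T] is a skew polynomial, which lets [D] be cut out of any ring
    where the nonzero skew polynomials are invertible.  The ring used here is that of the
    additive endomorphisms of [L^nat / {sequences with finite range}], where [t] acts as
    [x |-> x^2]: a nonzero skew polynomial acts as a linearized polynomial, which is
    surjective with finite fibers on [L].

    The center of [D] is [F_2], over which [t] is transcendental.  Finitely many elements
    of [D] commute with some [t^n], whose centralizer is finite dimensional over
    [F_2(t^n)]; by a density argument a division subring of it is finite dimensional over
    its own center.  Finitely many elements also have a common denominator commuting with
    all of them, and numerators over one finite field, so that the dimension of [V^r] is
    at most linear in [r]; for [V = <1, t>] it is at least [r + 1]. *)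
Require Import Defs.
From HB Require Import structures.
From mathcomp Require Import all_boot all_order all_algebra.
From mathcomp Require Import boolp classical_sets reals constructive_ereal ereal sequences exp.
From mathcomp Require Import Rstruct.
From mathcomp Require Import closed_field generic_quotient ring_quotient functions.

Set Implicit Arguments.
Unset Strict Implicit.
Unset Printing Implicit Defensive.

Import Order.TTheory GRing.Theory Num.Theory.
Local Open Scope classical_set_scope.
Local Open Scope ring_scope.

(** * Division subrings and left linear combinations over them *)

Section DivisionSubrings.
Variable D : unitRingType.
Implicit Types (K E A : set D) (s e : seq D) (x y : D).

Local Notation span K s := (lincomb K [set x | x \in s]).

Lemma divsubring0 K : is_divsubring K -> K 0.
Proof. by case=> K1 [KB _]; rewrite -(subrr 1); exact: KB. Qed.

Lemma divsubringN K x : is_divsubring K -> K x -> K (- x).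
Proof. by move=> KK Kx; rewrite -sub0r; apply: KK.2.1 => //; exact: divsubring0. Qed.

Lemma divsubringD K x y : is_divsubring K -> K x -> K y -> K (x + y).
Proof.
by move=> KK Kx Ky; rewrite -(opprK y); apply: KK.2.1 => //; exact: divsubringN.
Qed.

Lemma divsub_gen_divsubring (S : set D) : is_divsubring (divsub_gen S).
Proof.
split; [|split; [|split]].
- by move=> B [].
- by move=> x y gx gy B BB SB; apply: BB.2.1; [exact: gx|exact: gy].
- by move=> x y gx gy B BB SB; apply: BB.2.2.1; [exact: gx|exact: gy].
- by move=> x gx x0 B BB SB; apply: BB.2.2.2 => //; exact: gx.
Qed.

Definition centralizer (A : set D) : set D := [set z | forall y, A y -> z * y = y * z].

Lemma centralizer_divsubring A : is_division_ring D -> is_divsubring (centralizer A).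
Proof.
move=> divD; split; [|split; [|split]].
- by move=> y _; rewrite mulr1 mul1r.
- by move=> x y cx cy z Az; rewrite mulrBl mulrBr cx// cy.
- by move=> x y cx cy z Az; rewrite -mulrA cy// mulrA cx// mulrA.
- move=> x cx x0 z Az; have ux := divD _ x0.
  by apply: (mulrI ux); rewrite mulVKr// mulrA cx// mulrK.
Qed.

Lemma center_divsubring : is_division_ring D -> is_divsubring (@center D).
Proof.
move=> divD; rewrite (_ : @center D = centralizer setT); last first.
  by apply/seteqP; split=> z cz y; [move=> _; exact: cz|exact: (cz y I)].
exact: centralizer_divsubring.
Qed.

Lemma center_of_divsubring E : is_division_ring D -> is_divsubring E ->
  is_divsubring (center_of E).
Proof.
move=> divD EE; have [c1 [cB [cM cV]]] := centralizer_divsubring E divD.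
split; [|split; [|split]].
- by split; [exact: EE.1|exact: c1].
- by move=> x y [Ex cx] [Ey cy]; split; [exact: EE.2.1|exact: cB].
- by move=> x y [Ex cx] [Ey cy]; split; [exact: EE.2.2.1|exact: cM].
- by move=> x [Ex cx] x0; split; [exact: EE.2.2.2|exact: cV].
Qed.

Lemma lincomb0 K A : lincomb K A 0.
Proof. by exists [::]; split=> //; rewrite big_nil. Qed.

Lemma lincombD K A x y : lincomb K A x -> lincomb K A y -> lincomb K A (x + y).
Proof.
case=> s1 [h1 ->] [s2 [h2 ->]]; exists (s1 ++ s2); split; last by rewrite big_cat.
by move=> p; rewrite mem_cat => /orP[/h1|/h2].
Qed.

Lemma lincomb_scale K A k x : K k -> A x -> lincomb K A (k * x).
Proof.
move=> Kk Ax; exists [:: (k, x)]; split; last by rewrite big_seq1.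
by move=> p; rewrite inE => /eqP ->.
Qed.

Lemma lincomb_sub K A (P : set D) :
  P 0 -> (forall x y, P x -> P y -> P (x + y)) ->
  (forall k x, K k -> A x -> P (k * x)) -> lincomb K A `<=` P.
Proof.
move=> P0 PD PZ x [s [hs ->]]; rewrite big_seq.
by apply: big_ind => // p /hs[]; exact: PZ.
Qed.

Lemma lincombZ K A k x : is_divsubring K -> K k -> lincomb K A x -> lincomb K A (k * x).
Proof.
move=> KK Kk; move: x; apply: lincomb_sub => [|x y hx hy|c x Kc Ax].
- by rewrite mulr0; exact: lincomb0.
- by rewrite mulrDr; exact: lincombD.
- by rewrite mulrA; apply: lincomb_scale => //; exact: KK.2.2.1.
Qed.

Lemma lincombB K A x y : is_divsubring K ->
  lincomb K A x -> lincomb K A y -> lincomb K A (x - y).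
Proof.
move=> KK hx hy; apply: lincombD => //; rewrite -mulN1r.
by apply: lincombZ => //; apply: divsubringN => //; exact: KK.1.
Qed.

Lemma lincomb_mem K A : K 1 -> A `<=` lincomb K A.
Proof. by move=> K1 x Ax; rewrite -[x]mul1r; exact: lincomb_scale. Qed.

Lemma lincomb_lincomb K A B : is_divsubring K -> A `<=` lincomb K B ->
  lincomb K A `<=` lincomb K B.
Proof.
move=> KK AB; apply: lincomb_sub; [exact: lincomb0|by move=> *; exact: lincombD|].
by move=> k x Kk /AB; exact: lincombZ.
Qed.

Lemma lincombSl K K' A : K `<=` K' -> lincomb K A `<=` lincomb K' A.
Proof. by move=> KK' x [s [hs ->]]; exists s; split=> // p /hs[/KK']. Qed.

Lemma span_nil K x : span K [::] x -> x = 0.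
Proof. by move: x; apply: lincomb_sub => // x y -> ->; rewrite addr0. Qed.

Lemma span_cons K v s x : is_divsubring K ->
  span K (v :: s) x <-> exists2 k, K k & span K s (x - k * v).
Proof.
move=> KK; split=> [|[k Kk h]].
  move: x; apply: lincomb_sub => [|x y [k Kk hx] [l Kl hy]|k x Kk].
  - by exists 0; [exact: divsubring0|rewrite mul0r subrr; exact: lincomb0].
  - exists (k + l); first exact: divsubringD.
    by rewrite mulrDl opprD addrACA; exact: lincombD.
  - rewrite /= inE => /orP[/eqP ->|xs].
      by exists k => //; rewrite subrr; exact: lincomb0.
    exists 0; first exact: divsubring0.
    by rewrite mul0r subr0; exact: lincomb_scale.
rewrite -[x](subrK (k * v)); apply: lincombD.
  apply: lincomb_lincomb h => // y ys; apply: lincomb_mem; first exact: KK.1.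
  by rewrite /= inE ys orbT.
by apply: lincomb_scale => //=; rewrite mem_head.
Qed.

(* Gaussian elimination on the first vector of the spanning list. *)
Lemma span_subspace K s (P : set D) : is_division_ring D -> is_divsubring K ->
  P 0 -> (forall x y, P x -> P y -> P (x - y)) ->
  (forall k x, K k -> P x -> P (k * x)) -> P `<=` span K s ->
  exists2 s', (size s' <= size s)%N & span K s' = P.
Proof.
move=> divD KK; elim: s P => [|v s IH] P P0 PB PZ Ps.
  exists [::] => //; apply/seteqP; split=> x.
    by move/span_nil => ->.
  by move/Ps/span_nil ->; exact: lincomb0.
have [s' ss' Es'] := IH (P `&` span K s) (conj P0 (lincomb0 _ _))
  (fun x y hx hy => conj (PB _ _ hx.1 hy.1) (lincombB KK hx.2 hy.2))
  (fun k x hk hx => conj (PZ _ _ hk hx.1) (lincombZ KK hk hx.2)) (fun x h => h.2).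
have [h|] := pselect (P `<=` span K s).
  exists s'; first exact: leq_trans ss' _.
  by rewrite Es'; apply/seteqP; split=> [x []//|x Px]; split=> //; exact: h.
move=> /existsNP[w /not_implyP[Pw nw]].
have /(span_cons _ _ _ KK)[k Kk hk] := Ps _ Pw.
have k0 : k != 0 by apply/eqP => k0; apply: nw; rewrite k0 mul0r subr0 in hk.
exists (w :: s') => //; apply/seteqP; split=> x.
  move/(span_cons _ _ _ KK)=> [l Kl]; rewrite Es' => -[Px _].
  rewrite (_ : x = (x - l * w) - (0 - l * w)); last by rewrite sub0r opprK subrK.
  by apply: (PB) => //; apply: (PB) => //; exact: PZ.
move=> Px; have /(span_cons _ _ _ KK)[l Kl hl] := Ps _ Px.
have Klk : K (l * k^-1) by apply: KK.2.2.1 => //; exact: KK.2.2.2.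
apply/(span_cons _ _ _ KK); exists (l * k^-1) => //.
rewrite Es'; split; first by apply: PB => //; exact: PZ.
rewrite (_ : _ - _ = (x - l * v) - l * k^-1 * (w - k * v)).
  by apply: lincombB => //; exact: lincombZ.
by rewrite mulrBr -!mulrA (mulrA k^-1) mulVr ?divD// mul1r opprB addrA subrK.
Qed.

(** * Left linear independence and the exchange argument *)

Fixpoint indep K s : Prop :=
  if s is x :: s' then ~ span K s' x /\ indep K s' else True.

(** One exchange step: [w] is the last entry of [e] outside the span of [s], so its coordinate on
    [v] is nonzero, and subtracting multiples of [w] clears that coordinate from the entries before
    it. *)
Lemma indep_eliminate K v s e : is_division_ring D -> is_divsubring K ->
  indep K e -> [set x | x \in e] `<=` span K (v :: s) ->
  [set x | x \in e] `<=` span K s \/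
  exists w e', [/\ ~ span K s w, span K (v :: s) w, indep K e',
    [set x | x \in e'] `<=` span K s /\ size e = (size e').+1 &
    span K (w :: e') = span K e].
Proof.
move=> divD KK; elim: e => [|x e IH] /= => [_ _|[nx ie] es]; first by left=> x.
have es' : [set x | x \in e] `<=` span K (v :: s).
  by move=> y /= ye; apply: es; rewrite /= inE ye orbT.
have xvs : span K (v :: s) x by apply: es; rewrite /= mem_head.
have K1 := KK.1.
case: (IH ie es') => [es1|[w [e' [nw ws ie' [e's sze] Ee]]]].
  have [xs|nxs] := pselect (span K s x); first left.
    by move=> y /=; rewrite inE => /orP[/eqP ->|/es1].
  by right; exists x, e.
right.
have /(span_cons _ _ _ KK)[k Kk hk] := ws.
have k0 : k != 0 by apply/eqP => k0; apply: nw; rewrite k0 mul0r subr0 in hk.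
have /(span_cons _ _ _ KK)[l Kl hl] := xvs.
have Klk : K (l * k^-1) by apply: KK.2.2.1 => //; exact: KK.2.2.2.
pose x' := x - l * k^-1 * w.
have xE : x = x' + l * k^-1 * w by rewrite /x' subrK.
have x's : span K s x'.
  rewrite (_ : x' = (x - l * v) - l * k^-1 * (w - k * v)).
    by apply: lincombB => //; exact: lincombZ.
  by rewrite mulrBr -!mulrA (mulrA k^-1) mulVr ?divD// mul1r opprB addrA subrK mulrA.
exists w, (x' :: e'); split => //=.
- split => // x'e'; apply: nx; rewrite -Ee.
  by apply/(span_cons _ _ _ KK); exists (l * k^-1).
- split; last by rewrite sze.
  by move=> y /=; rewrite inE => /orP[/eqP ->|/e's].
have we : span K (x :: e) w.
  have : span K e w by rewrite -Ee; apply: lincomb_mem => //=; rewrite mem_head.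
  apply: lincomb_lincomb => // y ye; apply: lincomb_mem => //=.
  by rewrite inE ye orbT.
have xxe : span K (x :: e) x by apply: lincomb_mem => //=; rewrite mem_head.
apply/seteqP; split; apply: lincomb_lincomb => // y /=; rewrite !inE.
  case/or3P=> [/eqP -> //|/eqP ->|ye'].
    by apply: lincombB => //; exact: lincombZ.
  have : span K e y by rewrite -Ee; apply: lincomb_mem => //=; rewrite inE ye' orbT.
  apply: lincomb_lincomb => // z ze; apply: lincomb_mem => //=.
  by rewrite inE ze orbT.
case/orP=> [/eqP ->|ye].
  rewrite xE; apply: lincombD; first by apply: lincomb_mem => //=; rewrite !inE eqxx orbT.
  by apply: lincomb_scale => //=; rewrite mem_head.
have : span K (w :: e') y by rewrite Ee; exact: lincomb_mem.
apply: lincomb_lincomb => // z ze; apply: lincomb_mem => //=.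
by move: ze; rewrite /= !inE => /orP[] ->; rewrite ?orbT.
Qed.

(** Each vector of [s] is eliminated at the cost of at most one vector of [e]. *)
Lemma indep_size K s e : is_division_ring D -> is_divsubring K ->
  indep K e -> [set x | x \in e] `<=` span K s -> (size e <= size s)%N.
Proof.
move=> divD KK; elim: s e => [|v s IH] e ie es.
  case: e ie es => //= x e [nx _] es; exfalso; apply: nx.
  have /span_nil -> : span K [::] x by apply: es; rewrite /= mem_head.
  exact: lincomb0.
have [es1|[w [e' [_ _ ie' [e's ->] _]]]] := indep_eliminate divD KK ie es.
  exact/leqW/IH.
by rewrite ltnS; exact: IH.
Qed.

(** * Two-sided multiplication operators and density *)

Definition biop E : set (D -> D) :=
  [set T | exists2 s : seq (D * D), (forall p, p \in s -> E p.1 /\ E p.2) &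
     forall x, T x = \sum_(p <- s) p.1 * x * p.2].

Lemma biop_stable E T x : is_divsubring E -> biop E T -> E x -> E (T x).
Proof.
move=> EE [s hs hT] Ex; rewrite hT big_seq; apply: big_ind.
- exact: divsubring0.
- by move=> y z; exact: divsubringD.
- by move=> p /hs[h1 h2]; apply: EE.2.2.1 => //; exact: EE.2.2.1.
Qed.

Lemma biopB E T x y : biop E T -> T (x - y) = T x - T y.
Proof.
case=> s _ hT; rewrite !hT -sumrB; apply: eq_bigr => p _.
by rewrite mulrBr mulrBl.
Qed.

Lemma biopZ E T z x : biop E T -> centralizer E z -> T (z * x) = z * T x.
Proof.
case=> s hs hT cz; rewrite !hT mulr_sumr !big_seq; apply: eq_bigr => p /hs[h _].
by rewrite !mulrA cz.
Qed.

Lemma biop_span0 E T e x : biop E T -> (forall y, y \in e -> T y = 0) ->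
  span (centralizer E) e x -> T x = 0.
Proof.
move=> bT Te; move: x; apply: lincomb_sub => [|x y hx hy|k x ck /Te h].
- by have := biopB 0 0 bT; rewrite !subrr.
- case: bT hx hy => s _ hT; rewrite /= !hT => hx hy.
  under eq_bigr do rewrite mulrDr mulrDl.
  by rewrite big_split /= hx hy addr0.
- by rewrite (biopZ _ bT)// h mulr0.
Qed.

(* A Jacobson density argument. *)
Lemma biop_separates E e y : is_division_ring D -> is_divsubring E ->
  [set x | x \in e] `<=` E -> E y -> ~ span (center_of E) e y ->
  exists T, [/\ biop E T, forall x, x \in e -> T x = 0 & T y != 0].
Proof.
move=> divD EE; have ZE := center_of_divsubring divD EE.
elim: e y => [|x e IH] y eE Ey ny.
  exists id; split=> //.
    exists [:: (1, 1)]; last by move=> z; rewrite big_seq1 /= mul1r mulr1.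
    by move=> p; rewrite inE => /eqP -> /=; split; exact: EE.1.
  by apply/eqP => y0; apply: ny; rewrite y0; exact: lincomb0.
have eE' : [set x | x \in e] `<=` E by move=> z ze; apply: eE; rewrite /= inE ze orbT.
have Ex : E x by apply: eE; rewrite /= mem_head.
have nye : ~ span (center_of E) e y.
  move=> h; apply: ny; apply/(span_cons _ _ _ ZE).
  by exists 0; [exact: divsubring0|rewrite mul0r subr0].
(* If every operator killing [e] also kills [x], one separating [y] from [e] is enough. *)
have [allx|] := pselect (forall T, biop E T -> (forall x, x \in e -> T x = 0) -> T x = 0).
  have [T [bT Te Ty]] := IH _ eE' Ey nye; exists T; split=> // z.
  by rewrite inE => /orP[/eqP ->|/Te //]; exact: allx.
move=> /existsNP[T1 /not_implyP[bT1 /not_implyP[T1e /eqP T1x]]].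
pose T0 z := (T1 x)^-1 * T1 z.
have uT1x := divD _ T1x.
have ET1x : E (T1 x)^-1 by apply: EE.2.2.2 => //; exact: biop_stable EE bT1 Ex.
have bL a T : E a -> biop E T -> biop E (fun z => a * T z).
  move=> Ea [s hs hT]; exists [seq (a * p.1, p.2) | p <- s].
    by move=> _ /mapP[p /hs[h1 h2] ->] /=; split => //; exact: EE.2.2.1.
  by move=> z; rewrite hT big_map mulr_sumr; apply: eq_bigr => p _ /=; rewrite !mulrA.
have bR a T : E a -> biop E T -> biop E (fun z => T z * a).
  move=> Ea [s hs hT]; exists [seq (p.1, p.2 * a) | p <- s].
    by move=> _ /mapP[p /hs[h1 h2] ->] /=; split => //; exact: EE.2.2.1.
  by move=> z; rewrite hT big_map mulr_suml; apply: eq_bigr => p _ /=; rewrite !mulrA.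
have bB T U : biop E T -> biop E U -> biop E (fun z => T z - U z).
  move=> bT bU; have [s hs hT] := bT.
  have [u hu hU] := bL _ _ (divsubringN EE EE.1) bU.
  exists (s ++ u); first by move=> p; rewrite mem_cat => /orP[/hs|/hu].
  by move=> z; rewrite big_cat /= -hT -hU mulN1r.
have bT0 : biop E T0 by exact: bL.
have T0x : T0 x = 1 by rewrite /T0 mulVr.
have T0e z : z \in e -> T0 z = 0 by move=> ze; rewrite /T0 (T1e z)// mulr0.
have [[T [bT Te Tx Ty]]|nT] := pselect (exists T, [/\ biop E T,
    (forall z, z \in e -> T z = 0), T x = 0 & T y != 0]).
  exists T; split=> // z; rewrite inE => /orP[/eqP -> //|]; exact: Te.
(* Now every operator killing [e] and [x] kills [y]; this applies to [T - T x * T0], as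
   [T0 x = 1]. *)
have key T : biop E T -> (forall z, z \in e -> T z = 0) -> T y = T x * T0 y.
  move=> bT Te; apply/eqP; rewrite -subr_eq0; apply/negPn/negP => h; apply: nT.
  exists (fun z => T z - T x * T0 z); split=> //.
  - by apply: bB => //; apply: bL => //; exact: biop_stable EE bT Ex.
  - by move=> z ze; rewrite (Te z)// (T0e z)// mulr0 subrr.
  - by rewrite T0x mulr1 subrr.
(* For [T0] followed by right multiplication by [b], [key] reads [T0 y * b = b * T0 y]. *)
have Zz : center_of E (T0 y).
  split; first exact: biop_stable EE bT0 Ey.
  move=> b Eb; rewrite (key (fun z => T0 z * b)) ?T0x ?mul1r//; first exact: bR.
  by move=> z ze; rewrite (T0e z)// mul0r.
(* [y - T0 y * x] is outside the span of [e], yet by [key] every operator killing [e] kills it: a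
   contradiction with the induction hypothesis. *)
have [||T [bT Te]] := IH (y - T0 y * x) eE'.
- apply: EE.2.1 => //; apply: EE.2.2.1 => //; exact: Zz.1.
- by move=> h; apply: ny; apply/(span_cons _ _ _ ZE); exists (T0 y).
rewrite (biopB _ _ bT) (biopZ _ bT); last exact: Zz.2.
rewrite (key T)//.
by rewrite Zz.2 ?subrr ?eqxx//; exact: biop_stable EE bT Ex.
Qed.

(** The operators of [biop E] are linear over the centralizer of [E], so by density vectors of [E]
    independent over its center stay independent over its centralizer. Hence such lists are no
    longer than [s], and a maximal one spans [E] over its center. *)
Lemma findim_over_own_centerP E s : is_division_ring D -> is_divsubring E ->
  E `<=` span (centralizer E) s -> findim_over_own_center E.
Proof.
move=> divD EE Es; have ZE := center_of_divsubring divD EE.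
have cE := centralizer_divsubring E divD.
have indepC e : [set x | x \in e] `<=` E -> indep (center_of E) e ->
    indep (centralizer E) e.
  elim: e => //= x e IH eE [nx ie].
  have eE' : [set x | x \in e] `<=` E by move=> z ze; apply: eE; rewrite /= inE ze orbT.
  split; last exact: IH.
  have Ex : E x by apply: eE; rewrite /= mem_head.
  have [T [bT Te /eqP Tx]] := biop_separates divD EE eE' Ex nx.
  by move=> h; apply: Tx; exact: biop_span0 bT Te h.
have maximal e : [set x | x \in e] `<=` E -> E `<=` span (center_of E) e ->
    findim_over_own_center E.
  move=> eE Ee; exists e; apply/seteqP; split=> //.
  apply: lincomb_sub => [|x y|z x [Ez _] /eE Ex].
  - exact: divsubring0.
  - exact: divsubringD.
  - exact: EE.2.2.1.
(* [k] bounds the number of vectors by which [e] can still be extended. *)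
suff H k e : [set x | x \in e] `<=` E -> indep (center_of E) e ->
    (size s <= size e + k)%N -> findim_over_own_center E.
  by apply: (H (size s) [::]) => // x.
elim: k e => [|k IH] e eE ie sk;
  (have [Ee|] := pselect (E `<=` span (center_of E) e); first exact: maximal eE Ee);
  move=> /existsNP[x /not_implyP[Ex nx]];
  have xeE : [set y | y \in x :: e] `<=` E
    by move=> y /=; rewrite inE => /orP[/eqP -> //|]; exact: eE.
  have : (size (x :: e) <= size s)%N.
    by apply: (indep_size divD cE); [exact: indepC|move=> y /xeE /Es].
  by rewrite addn0 in sk; rewrite /= ltnNge sk.
by apply: (IH (x :: e)) => //=; rewrite addSnnS.
Qed.

End DivisionSubrings.

(** * Evaluation of skew polynomials *)

Section SkewPolynomials.
Variables (L : fieldType) (R : nzRingType) (sc : {rmorphism L -> R}) (t : R).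

(** [{poly L}] serves only as the group of coefficient lists: coefficients stand to the left of the
    powers of [t], and evaluation is additive and left linear but in general not multiplicative. *)
Definition skew_eval (a : {poly L}) : R := (map_poly sc a).[t].

Lemma skew_eval_coef a : skew_eval a = \sum_(i < size a) sc a`_i * t ^+ i.
Proof.
rewrite /skew_eval horner_coef size_map_poly.
by apply: eq_bigr => i _; rewrite coef_map.
Qed.

Lemma skew_eval_is_additive : zmod_morphism skew_eval.
Proof. by move=> a b; rewrite /skew_eval raddfB /= hornerD hornerN. Qed.

HB.instance Definition _ := GRing.isZmodMorphism.Build {poly L} R skew_eval
  skew_eval_is_additive.

Lemma skew_evalZ c a : skew_eval (c *: a) = sc c * skew_eval a.
Proof. by rewrite /skew_eval map_polyZ hornerZ. Qed.

Lemma skew_evalC c : skew_eval c%:P = sc c.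
Proof. by rewrite /skew_eval map_polyC hornerC. Qed.

Lemma skew_evalMX a : skew_eval (a * 'X) = skew_eval a * t.
Proof. by rewrite /skew_eval rmorphM /= map_polyX hornerMX. Qed.

Lemma skew_evalXn n : skew_eval 'X^n = t ^+ n.
Proof. by rewrite /skew_eval map_polyXn hornerXn. Qed.

Lemma skew_evalMXn a n : skew_eval (a * 'X^n) = skew_eval a * t ^+ n.
Proof.
by elim: n => [|n IH]; rewrite ?mulr1// exprSr mulrA skew_evalMX IH exprSr mulrA.
Qed.

(** For [n > 0], the coefficients lie in the field of 2^n elements; these are the skew polynomials
    commuting with [t ^+ n]. *)
Definition frobenius_fixed n (a : {poly L}) := forall i, a`_i ^+ (2 ^ n) = a`_i.

End SkewPolynomials.

(* An overring of the skew polynomial ring [L[t; Frobenius]] where the nonzero skew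
   polynomials are invertible, with [L] algebraic over [F_2]. *)
Record skewRing (L : closedFieldType) := SkewRing {
  skew_ring :> unitRingType;
  skew_scal : {rmorphism L -> skew_ring};
  skew_var : skew_ring;
  skew_pchar : 2%N \in [pchar L];
  skew_locally_finite : forall x : L, exists2 n, (0 < n)%N & x ^+ (2 ^ n) = x;
  skew_comm : forall x : L, skew_var * skew_scal x = skew_scal (x ^+ 2) * skew_var;
  skew_unit : forall a : {poly L}, a != 0 ->
    skew_eval skew_scal skew_var a \is a GRing.unit }.

(** * Finite sets of polynomials and iterates of the Frobenius map *)

Lemma poly_coef_finite (R : nzRingType) (c : seq R) d :
  exists s : seq {poly R}, forall a : {poly R},
    (forall i, a`_i \in c) -> (size a <= d)%N -> a \in s.
Proof.
elim: d => [|d [s IH]].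
  by exists [:: 0] => a _; rewrite leqn0 size_poly_eq0 inE.
exists [seq p * 'X + x%:P | p <- s, x <- c] => a ac sa.
have Ea : a = drop_poly 1 a * 'X + (a`_0)%:P.
  apply/polyP => i; rewrite coefD coefMX coefC.
  by case: i => [|i] /=; rewrite ?add0r// coef_drop_poly addr0 addn1.
rewrite Ea; apply: allpairs_f => //; apply: IH => [i|].
  by rewrite coef_drop_poly.
by rewrite size_drop_poly leq_subLR.
Qed.

Section ClosedFieldFrobenius.
Variable L : closedFieldType.
Implicit Types (x : L) (a : {poly L}).

Lemma closed_field_roots a : a != 0 -> exists s : seq L, forall x, root a x -> x \in s.
Proof.
move=> a0; have [s Es] := closed_field_poly_normal a; exists s => x.
by rewrite Es rootZ ?lead_coef_eq0// root_prod_XsubC.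
Qed.

Lemma frobenius_iter n m x : x ^+ (2 ^ (n + m)) = (x ^+ (2 ^ n)) ^+ (2 ^ m).
Proof. by rewrite -exprM expnD. Qed.

Lemma frobenius_iter_fixed n m x : (n %| m)%N -> x ^+ (2 ^ n) = x -> x ^+ (2 ^ m) = x.
Proof.
move=> /dvdnP[q ->] h; elim: q => [|q IH]; first by rewrite mul0n expr1.
by rewrite mulSn frobenius_iter h IH.
Qed.

Hypothesis char2 : 2%N \in [pchar L].

Lemma frobeniusD n x y : (x + y) ^+ (2 ^ n) = x ^+ (2 ^ n) + y ^+ (2 ^ n).
Proof.
rewrite exprDn_pchar// pnatX (pnatE _ (pcharf_prime char2)).
by rewrite char2.
Qed.

Lemma frobeniusB n x y : (x - y) ^+ (2 ^ n) = x ^+ (2 ^ n) - y ^+ (2 ^ n).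
Proof. by rewrite !(oppr_pchar2 char2) frobeniusD. Qed.

Lemma frobenius0 n : (0 : L) ^+ (2 ^ n) = 0.
Proof. by rewrite expr0n expn_eq0. Qed.

Lemma frobenius_inj n : injective (fun x : L => x ^+ (2 ^ n)).
Proof.
move=> x y /eqP; rewrite -subr_eq0 -frobeniusB expf_eq0 => /andP[_].
by rewrite subr_eq0 => /eqP.
Qed.

Lemma frobenius_moves n : (0 < n)%N -> exists x : L, x ^+ (2 ^ n) != x.
Proof.
move=> n0; have n2 : (1 < 2 ^ n)%N by rewrite -{1}(expn0 2) ltn_exp2l.
(* The equation solved is [x ^+ (2 ^ n) = 1 + x]. *)
have := @solve_monicpoly L (2 ^ n)%N (fun i => if (i < 2)%N then 1 else 0).
case=> [|x Ex]; first by rewrite expn_gt0.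
exists x; apply/eqP => h; move: Ex; rewrite h.
rewrite -(subnK n2) addnC big_split_ord /= big_ord_recl big_ord1 /=.
rewrite big1 => [|i _]; last by rewrite mul0r.
rewrite !mul1r expr1 expr0 addr0 => /eqP; rewrite -subr_eq0 opprD addrCA subrr addr0.
by rewrite oppr_eq0 oner_eq0.
Qed.

Lemma frobenius_separates n m : n != m -> exists x : L, x ^+ (2 ^ n) != x ^+ (2 ^ m).
Proof.
wlog lt_nm : n m / (n < m)%N => [H|_].
  rewrite neq_ltn => /orP[h|h]; first by apply: H => //; rewrite ltn_eqF.
  by have [|x hx] := H m n h; [rewrite ltn_eqF|exists x; rewrite eq_sym].
have [x hx] : exists x : L, x ^+ (2 ^ (m - n)) != x by apply: frobenius_moves; rewrite subn_gt0.
exists x; rewrite -(subnK (ltnW lt_nm)) frobenius_iter eq_sym.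
by apply: contra hx => /eqP /(@frobenius_inj n) ->.
Qed.

Lemma frobenius_fixed_finite n : (0 < n)%N ->
  exists s : seq L, forall x, x ^+ (2 ^ n) = x -> x \in s.
Proof.
move=> n0; have [|s hs] := @closed_field_roots ('X^(2 ^ n) - 'X).
  have [x hx] := frobenius_moves n0; apply/eqP => /(congr1 (fun p : {poly L} => p.[x])).
  by rewrite !hornerE => /eqP; rewrite subr_eq0 (negPf hx).
by exists s => x hx; apply: hs; rewrite /root !hornerE hx subrr.
Qed.

Lemma frobenius_fixed_poly_finite n d : (0 < n)%N ->
  exists s : seq {poly L}, forall a, frobenius_fixed n a -> (size a <= d)%N -> a \in s.
Proof.
move=> n0; have [sn hsn] := frobenius_fixed_finite n0.
have [s hs] := poly_coef_finite sn d.
by exists s => a fa; apply: hs => i; exact: hsn.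
Qed.

End ClosedFieldFrobenius.

Lemma pigeonhole_nat (T : eqType) (f : nat -> T) (s : seq T) :
  (forall i, f i \in s) -> exists i j, (i < j)%N /\ f i = f j.
Proof.
move=> fs; apply: contrapT => nf.
have uf : uniq (map f (iota 0 (size s).+1)).
  rewrite map_inj_uniq ?iota_uniq// => i j fij; apply/eqP.
  case: ltngtP => // ij; exfalso; apply: nf; first by exists i, j.
  by exists j, i.
have : (size (map f (iota 0 (size s).+1)) <= size s)%N.
  by apply: uniq_leq_size => // _ /mapP[i _ ->].
by rewrite size_map size_iota ltnn.
Qed.

(** * Fractions with denominators [t^j (t^k - 1)] *)

Section SkewFractions.
Variables (L : closedFieldType) (S : skewRing L).
Implicit Types (x : L) (a b : {poly L}) (T U : S).

Local Notation sc := (skew_scal S).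
Local Notation t := (skew_var S).
Local Notation op := (skew_eval sc t).
Let char2 := skew_pchar S.

(** A nonzero difference would evaluate to a unit, hence not to 0. *)
Lemma skew_eval_inj : injective op.
Proof.
move=> a b /eqP; rewrite -subr_eq0 -raddfB /= => /eqP ab0; apply/eqP.
rewrite -subr_eq0; apply: contraT => /(@skew_unit L S).
by rewrite ab0 unitr0.
Qed.

Lemma skew_eval_eq0 a : op a = 0 -> a = 0.
Proof. by move=> h; apply: skew_eval_inj; rewrite h raddf0. Qed.

Lemma skew_var_unit : t \is a GRing.unit.
Proof.
by have := @skew_unit L S _ (negbT (polyX_eq0 L)); rewrite -['X]expr1 skew_evalXn.
Qed.

Lemma skew_varX_scal n x : t ^+ n * sc x = sc (x ^+ (2 ^ n)) * t ^+ n.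
Proof.
elim: n x => [|n IH] x; first by rewrite mul1r mulr1 expr1.
by rewrite exprSr -mulrA skew_comm mulrA IH -exprM -expnS mulrA.
Qed.

Lemma skew_varX_eval n a :
  t ^+ n * op a = op (map_poly (fun x => x ^+ (2 ^ n)) a) * t ^+ n.
Proof.
elim/poly_ind: a => [|a c IH]; first by rewrite map_poly0 !raddf0 mulr0 mul0r.
have -> : map_poly (fun x => x ^+ (2 ^ n)) (a * 'X + c%:P) =
    map_poly (fun x => x ^+ (2 ^ n)) a * 'X + (c ^+ (2 ^ n))%:P.
  apply/polyP => i; rewrite coef_map_id0 ?frobenius0// !coefD !coefMX !coefC.
  case: i => [|i] /=; first by rewrite !add0r.
  by rewrite coef_map_id0 ?frobenius0// !addr0.
rewrite !raddfD /= !skew_evalMX !skew_evalC mulrDr mulrDl skew_varX_scal mulrA IH.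
by rewrite -!mulrA -exprS -exprSr.
Qed.

Lemma skew_eval_commP n a : t ^+ n * op a = op a * t ^+ n <-> frobenius_fixed n a.
Proof.
rewrite skew_varX_eval; split=> [h i|fa].
  have /(mulIr (unitrX n skew_var_unit))/skew_eval_inj E := h.
  by rewrite -[in RHS]E coef_map_id0 ?frobenius0.
congr (op _ * _); apply/polyP => i.
by rewrite coef_map_id0 ?frobenius0//; exact: fa.
Qed.

(** Each of the finitely many coefficients lies in a finite field; the product of the exponents
    works for all. *)
Lemma frobenius_fixed_ex a : exists2 n, (0 < n)%N & frobenius_fixed n a.
Proof.
elim/poly_ind: a => [|a c [n n0 fa]].
  by exists 1%N => // i; rewrite coef0 frobenius0.
have [m m0 fc] := skew_locally_finite S c.
exists (n * m)%N; first by rewrite muln_gt0 n0.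
case=> [|i]; rewrite coefD coefMX coefC /= ?add0r ?addr0.
  by apply: frobenius_iter_fixed fc; exact: dvdn_mull.
by apply: frobenius_iter_fixed (fa i); exact: dvdn_mulr.
Qed.

(** The product is expanded by moving each [t] of [a] to the right across [b], which squares the
    coefficients of [b]; hence the induction on [a] for all [b]. Size and field of coefficients are
    tracked for the growth estimate. *)
Lemma skew_eval_mul a b : exists p, [/\ op p = op a * op b,
  (size p <= size a + size b)%N &
  forall n, frobenius_fixed n a -> frobenius_fixed n b -> frobenius_fixed n p].
Proof.
elim/poly_ind: a b => [|a c IH] b.
  by exists 0; split=> //; rewrite ?raddf0 ?mul0r// size_poly0.
pose b1 := map_poly (fun x => x ^+ (2 ^ 1)) b.
have tb : t * op b = op (b1 * 'X) by rewrite -[t in LHS]expr1 skew_varX_eval skew_evalMX.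
have sb1 : (size (b1 * 'X)%R <= (size b).+1)%N.
  have [->|b10] := eqVneq b1 0; first by rewrite mul0r size_poly0.
  by rewrite size_mulX// ltnS; exact: size_poly.
have fcb n : frobenius_fixed n (a * 'X + c%:P) -> frobenius_fixed n b ->
    frobenius_fixed n (c *: b).
  move=> fa fb i; rewrite coefZ exprMn fb.
  by have := fa 0%N; rewrite coefD coefMX coefC /= add0r => ->.
have [a0|a0] := eqVneq a 0.
  exists (c *: b); split=> //.
    by rewrite a0 mul0r add0r skew_evalZ skew_evalC.
  by apply: leq_trans (size_scale_leq _ _) _; exact: leq_addl.
have [p [pE sp fp]] := IH (b1 * 'X).
exists (p + c *: b); split.
- rewrite raddfD /= skew_evalZ pE raddfD /= skew_evalC mulrDl.
  by rewrite (skew_evalMX _ _ a) -mulrA tb.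
- apply: leq_trans (size_polyD _ _) _; rewrite size_MXaddC (negPf a0) /= geq_max.
  rewrite (leq_trans sp) ?addSnnS ?leq_add2l//=.
  by apply: leq_trans (size_scale_leq _ _) _; rewrite -?addSnnS leq_addl.
move=> n fa fb i; rewrite coefD (frobeniusD char2) (fcb n fa fb) (fp n)//.
  by move=> k; have := fa k.+1; rewrite coefD coefMX coefC /= addr0.
case=> [|k]; rewrite coefMX/= ?frobenius0// coef_map_id0 ?frobenius0//.
by rewrite -!exprM mulnC exprM fb.
Qed.

(* In characteristic 2 the square of a denominator is again one. *)
Definition skew_den j k : S := t ^+ j * (t ^+ k - 1).

Lemma skew_den_comm j k m : t ^+ m * skew_den j k = skew_den j k * t ^+ m.
Proof.
rewrite /skew_den mulrA -exprD addnC exprD -!mulrA; congr (_ * _).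
by rewrite mulrBr mulrBl mul1r mulr1 -!exprD addnC.
Qed.

Lemma skew_denE j k : skew_den j k = op ('X^(j + k) - 'X^j).
Proof. by rewrite raddfB /= !skew_evalXn /skew_den mulrBr mulr1 exprD. Qed.

Lemma skew_den_unit j k : (0 < k)%N -> skew_den j k \is a GRing.unit.
Proof.
move=> k0; rewrite skew_denE; apply: skew_unit.
rewrite exprD -[X in _ - X]mulr1 -mulrBr mulf_neq0 ?monic_neq0 ?monicXn//.
exact: monicXnsubC.
Qed.

(** A geometric sum: [t^k - 1] divides [t^(qk) - 1]. This makes common denominators possible. *)
Lemma skew_den_dvd j k j' k' : (j <= j')%N -> (k %| k')%N ->
  exists a, skew_den j' k' = op a * skew_den j k.
Proof.
move=> jj' /dvdnP[q ->].
pose e : {poly L} := (\sum_(i < q) 'X^(k * i)) * 'X^(j' - j).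
exists e; rewrite /e skew_evalMXn raddf_sum /=.
under eq_bigr do rewrite skew_evalXn.
rewrite -mulrA [_ * skew_den _ _]mulrA -exprD subnK// mulrA.
under eq_bigr do rewrite exprM.
have cjq : (\sum_(i < q) (t ^+ k) ^+ i) * t ^+ j' = t ^+ j' * (\sum_(i < q) (t ^+ k) ^+ i).
  rewrite mulr_suml mulr_sumr; apply: eq_bigr => i _.
  by rewrite -exprM -!exprD addnC.
rewrite cjq /skew_den -mulrA; congr (_ * _).
rewrite mulnC exprM subrX1 mulr_suml mulr_sumr; apply: eq_bigr => i _.
by rewrite mulrBl mulrBr mul1r mulr1 -exprS -exprSr.
Qed.

Lemma skew_den_sq j k : skew_den j k * skew_den j k = skew_den (j + j) (k + k).
Proof.
have tt : (1 + 1 : S) = 0.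
  by rewrite -(rmorph1 sc) -rmorphD /= (addrr_pchar2 char2) rmorph0.
rewrite {2}/skew_den mulrA -skew_den_comm /skew_den mulrA -exprD -mulrA.
have N1 : - 1 = 1 :> S by apply/eqP; rewrite -subr_eq0 -opprD tt oppr0.
have uu : t ^+ k + t ^+ k = 0 by rewrite -[t ^+ k]mul1r -mulrDl tt mul0r.
congr (_ * _); rewrite !N1 mulrDl !mulrDr !mulr1 mul1r exprD addrA.
by rewrite -(addrA (t ^+ k * t ^+ k)) uu addr0.
Qed.

(** Denominators of this shape suffice for all fractions by [skew_eval_dvd_den], and being
    polynomials in [t] over the prime field they commute with each other. *)
Definition skew_frac T : Prop :=
  exists j k a, (0 < k)%N /\ skew_den j k * T = op a.

Lemma skew_frac_den T : skew_frac T -> exists j k, (0 < k)%N /\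
  forall j' k', (j <= j')%N -> (k %| k')%N -> exists a, skew_den j' k' * T = op a.
Proof.
move=> [j [k [a [k0 E]]]]; exists j, k; split=> // j' k' jj' kk'.
have [b ->] := skew_den_dvd jj' kk'; rewrite -mulrA E.
by have [p [<- _ _]] := skew_eval_mul b a; exists p.
Qed.

Lemma skew_frac_comm T : skew_frac T -> exists2 n, (0 < n)%N & t ^+ n * T = T * t ^+ n.
Proof.
move=> [j [k [a [k0 E]]]]; have [n n0 /skew_eval_commP fa] := frobenius_fixed_ex a.
exists n => //; apply: (mulrI (skew_den_unit j k0)).
by rewrite !mulrA -skew_den_comm -mulrA E fa.
Qed.

Lemma skew_den_comm_dvd n j k T : (n %| j)%N -> (n %| k)%N ->
  t ^+ n * T = T * t ^+ n -> skew_den j k * T = T * skew_den j k.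
Proof.
move=> /dvdnP[p ->] /dvdnP[q ->] cT; apply: commr_sym.
have c m : GRing.comm T (t ^+ (m * n)) by rewrite mulnC exprM; exact/commrX/esym.
by apply: commrM => //; apply: commrB => //; exact: commr1.
Qed.

Lemma skew_frac_common_comm (s : seq S) : (forall T, T \in s -> skew_frac T) ->
  exists2 n, (0 < n)%N & forall T, T \in s -> t ^+ n * T = T * t ^+ n.
Proof.
elim: s => [|T s IH] hs; first by exists 1%N.
have [n n0 hn] : exists2 n, (0 < n)%N & forall T, T \in s -> t ^+ n * T = T * t ^+ n.
  by apply: IH => U Us; apply: hs; rewrite inE Us orbT.
have [m m0 hm] := skew_frac_comm (hs T (mem_head _ _)).
exists (m * n)%N => [|U]; first by rewrite muln_gt0 m0.
rewrite inE => /orP[/eqP ->|/hn c]; last rewrite mulnC; rewrite exprM.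
  exact/commr_sym/commrX/esym.
exact/commr_sym/commrX/esym.
Qed.

(** A common denominator exists by divisibility. Multiplying both its exponents by [n] makes it a
    polynomial in [t ^+ n], so that it commutes with all of [s] and the numerators commute with
    [t ^+ n]. *)
Lemma skew_frac_common (s : seq S) n : (0 < n)%N -> (forall T, T \in s -> skew_frac T) ->
  (forall T, T \in s -> t ^+ n * T = T * t ^+ n) ->
  exists j k, [/\ (0 < k)%N, (n %| j)%N, (n %| k)%N &
    forall T, T \in s -> skew_den j k * T = T * skew_den j k /\
      exists2 a, frobenius_fixed n a & skew_den j k * T = op a].
Proof.
move=> n0 hs cs.
have [j [k [k0 hjk]]] : exists j k, (0 < k)%N /\ forall T, T \in s ->
    forall j' k', (j <= j')%N -> (k %| k')%N -> exists a, skew_den j' k' * T = op a.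
  elim: s hs {cs} => [|T s IH] hs; first by exists 0%N, 1%N.
  have [j [k [k0 hjk]]] : exists j k, (0 < k)%N /\ forall T, T \in s ->
      forall j' k', (j <= j')%N -> (k %| k')%N -> exists a, skew_den j' k' * T = op a.
    by apply: IH => U Us; apply: hs; rewrite inE Us orbT.
  have [j1 [k1 [k10 hjk1]]] := skew_frac_den (hs T (mem_head _ _)).
  exists (j + j1)%N, (k * k1)%N; split=> [|U]; first by rewrite muln_gt0 k0.
  rewrite inE => Us j' k' lej dvk; case/orP: Us => [/eqP ->|/hjk h]; [apply: hjk1|apply: h].
  - exact: leq_trans (leq_addl _ _) lej.
  - exact: dvdn_trans (dvdn_mull _ _) dvk.
  - exact: leq_trans (leq_addr _ _) lej.
  - exact: dvdn_trans (dvdn_mulr _ _) dvk.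
exists (j * n)%N, (k * n)%N; rewrite muln_gt0 k0 !dvdn_mull//; split=> // T Ts.
have cT : skew_den (j * n) (k * n) * T = T * skew_den (j * n) (k * n).
  by apply: (skew_den_comm_dvd (n := n)); rewrite ?dvdn_mull// cs.
split=> //.
have [|//|a E] := hjk T Ts (j * n)%N (k * n)%N; rewrite ?leq_pmulr ?dvdn_mulr//.
exists a => //; apply/skew_eval_commP.
by rewrite -E mulrA skew_den_comm -!mulrA cs.
Qed.

Lemma skew_frac_eval a : skew_frac (op a).
Proof.
have [p [Ep _ _]] := skew_eval_mul ('X^(0 + 1) - 'X^0) a.
by exists 0%N, 1%N, p; rewrite skew_denE Ep.
Qed.

Lemma skew_fracB T U : skew_frac T -> skew_frac U -> skew_frac (T - U).
Proof.
move=> fT fU.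
have hs V : V \in [:: T; U] -> skew_frac V by rewrite !inE => /orP[]/eqP ->.
have [n n0 hn] := skew_frac_common_comm hs.
have [j [k [k0 _ _ hjk]]] := skew_frac_common n0 hs hn.
have [_ [a _ Ea]] := hjk T (mem_head _ _).
have [_ [b _ Eb]] := hjk U ltac:(by rewrite !inE eqxx orbT).
by exists j, k, (a - b); split=> //; rewrite mulrBr Ea Eb raddfB.
Qed.

(** With a common denominator [C] commuting with [T], [C * C * (T * U) = (C * T) * (C * U)], and
    [C * C] is again a denominator. *)
Lemma skew_fracM T U : skew_frac T -> skew_frac U -> skew_frac (T * U).
Proof.
move=> fT fU.
have hs V : V \in [:: T; U] -> skew_frac V by rewrite !inE => /orP[]/eqP ->.
have [n n0 hn] := skew_frac_common_comm hs.
have [j [k [k0 _ _ hjk]]] := skew_frac_common n0 hs hn.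
have [cT [a _ Ea]] := hjk T (mem_head _ _).
have [_ [b _ Eb]] := hjk U ltac:(by rewrite !inE eqxx orbT).
have [p [Ep _ _]] := skew_eval_mul a b.
exists (j + j)%N, (k + k)%N, p; split; first by rewrite addn_gt0 k0.
by rewrite -skew_den_sq Ep -Ea -Eb -(mulrA _ T (_ * U)) (mulrA T) -cT !mulrA.
Qed.

Lemma skew_frac_unit T : skew_frac T -> T != 0 -> T \is a GRing.unit.
Proof.
move=> [j [k [a [k0 E]]]] T0; have uden := skew_den_unit j k0.
have : skew_den j k * T \is a GRing.unit.
  rewrite E; apply: skew_unit; apply: contraNneq T0 => a0.
  by rewrite -(mulKr uden T) E a0 raddf0 mulr0.
by rewrite unitrMr.
Qed.

(** One step of division by [a]. The factor [c] is 0 if [r] is already shorter than [a], and lies in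
    the field of 2^n elements, so the remainder keeps its coefficients there. *)
Lemma skew_eval_rem n a r : a != 0 -> frobenius_fixed n a -> frobenius_fixed n r ->
  (size r <= size a)%N -> exists c r', [/\ op r = sc c * op a + op r',
    frobenius_fixed n r' & (size r' < size a)%N].
Proof.
move=> a0 fa fr sr; pose c := r`_(size a).-1 / lead_coef a.
have la0 : lead_coef a != 0 by rewrite lead_coef_eq0.
exists c, (r - c *: a); split.
- by rewrite raddfB /= skew_evalZ addrC subrK.
- move=> i; rewrite coefB coefZ (frobeniusB char2) fr exprMn fa.
  by rewrite /c exprMn exprVn fr /lead_coef fa.
have sa : (0 < size a)%N by rewrite size_poly_gt0.
rewrite -(prednK sa) ltnS; apply/leq_sizeP => i; rewrite leq_eqVlt => /orP[/eqP <-|hi].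
  by rewrite coefB coefZ /c -/(lead_coef a) divfK// subrr.
rewrite prednK// in hi.
by rewrite coefB coefZ !nth_default ?mulr0 ?subr0//; exact: leq_trans sr hi.
Qed.

(** Write [t^i = b_i a + r_i] with [r_i] shorter than [a] and over one finite field. Two of these
    remainders coincide, and the difference of the two powers of [t] is a left multiple of [a]. *)
Lemma skew_eval_dvd_den a : a != 0 ->
  exists j k b, (0 < k)%N /\ skew_den j k = op b * op a.
Proof.
move=> a0; have [n n0 fa] := frobenius_fixed_ex a.
have f1 : frobenius_fixed n (1 : {poly L}).
  by move=> i; rewrite coef1; case: eqP => _; rewrite ?expr1n ?frobenius0.
have rem i : exists r b, [/\ frobenius_fixed n r, (size r < size a)%N &
    t ^+ i = op b * op a + op r].
  elim: i => [|i [r [b [fr sr E]]]].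
    have [|c [r' [E fr' sr']]] := skew_eval_rem a0 fa f1.
      by rewrite size_poly1 size_poly_gt0.
    by exists r', c%:P; split=> //; rewrite skew_evalC -E -(expr0 'X) skew_evalXn.
  (* The next remainder comes from reducing [t * op r], one degree higher and with squared
     coefficients. *)
  pose r1 := map_poly (fun x => x ^+ (2 ^ 1)) r * 'X.
  have Er1 : t * op r = op r1 by rewrite -[t in LHS]expr1 skew_varX_eval skew_evalMX.
  have fr1 : frobenius_fixed n r1.
    case=> [|m]; rewrite coefMX /= ?frobenius0// coef_map_id0 ?frobenius0//.
    by rewrite -!exprM mulnC exprM fr.
  have sr1 : (size r1 <= size a)%N.
    have [h|h] := eqVneq (map_poly (fun x => x ^+ (2 ^ 1)) r) 0.
      by rewrite /r1 h mul0r size_poly0.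
    by rewrite /r1 size_mulX//; apply: leq_trans sr; rewrite ltnS; exact: size_poly.
  have [c [r' [E' fr' sr']]] := skew_eval_rem a0 fa fr1 sr1.
  have [p [Ep _ _]] := skew_eval_mul 'X b.
  exists r', (p + c%:P); split=> //.
  rewrite exprS E mulrDr Er1 E' raddfD /= skew_evalC Ep -(expr1 'X) skew_evalXn expr1.
  by rewrite mulrDl !mulrA addrA.
have [r hr] := choice rem.
have [s hs] := frobenius_fixed_poly_finite L (size a) n0.
have [|i [j [ij Er]]] := @pigeonhole_nat _ r s.
  by move=> i; have [b [fr sr _]] := hr i; apply: hs => //; exact: ltnW.
have [b [_ _ Ei]] := hr i; have [b' [_ _ Ej]] := hr j.
exists i, (j - i)%N, (b' - b); split; first by rewrite subn_gt0.
rewrite skew_denE raddfB /= !skew_evalXn (subnKC (ltnW ij)) Ei Ej Er raddfB /= mulrBl.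
by rewrite opprD addrACA subrr addr0.
Qed.

(** If [C * T = op a], then [T^-1] is the inverse of [op a] times [C]; a denominator of the form
    [op b * op a] thus sends [T^-1] to [op b * C]. *)
Lemma skew_fracV T : skew_frac T -> skew_frac T^-1.
Proof.
move=> fT; have [uT|nuT] := boolP (T \is a GRing.unit); last by rewrite invr_out.
have [j [k [a [k0 E]]]] := fT; have uden := skew_den_unit j k0.
have a0 : a != 0.
  apply: contraTneq uT => a0.
  by rewrite -(mulKr uden T) E a0 raddf0 mulr0 unitr0.
have [j' [k' [b [k'0 E']]]] := skew_eval_dvd_den a0.
have [p [Ep _ _]] := skew_eval_mul b ('X^(j + k) - 'X^j).
exists j', k', p; split=> //.
by rewrite Ep -skew_denE E' -E -!mulrA mulrV ?mulr1.
Qed.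

Definition skew_fracs : {pred S} := [pred T | `[< skew_frac T >]].

Lemma skew_fracs_divring_closed : divring_closed skew_fracs.
Proof.
split.
- by apply/asboolP; have := skew_frac_eval 1; rewrite -(expr0 'X) skew_evalXn.
- by move=> T U /asboolP fT /asboolP fU; apply/asboolP; exact: skew_fracB.
- by move=> T U /asboolP fT /asboolP fU; apply/asboolP/skew_fracM/skew_fracV.
Qed.

HB.instance Definition _ := GRing.isDivringClosed.Build S skew_fracs
  skew_fracs_divring_closed.

Definition skew_frac_ring := {T : S | T \in skew_fracs}.
HB.instance Definition _ := SubChoice.on skew_frac_ring.
HB.instance Definition _ := [SubChoice_isSubUnitRing of skew_frac_ring by <:].

End SkewFractions.

(** * The fractions as a division ring of their own *)

Section SkewFractionRing.
Variables (L : closedFieldType) (S : skewRing L).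

Local Notation D := (skew_frac_ring S).

Lemma skew_fracs_eval (a : {poly L}) :
  skew_eval (skew_scal S) (skew_var S) a \in @skew_fracs L S.
Proof. exact/asboolP/skew_frac_eval. Qed.

Definition skew_frac_eval_sub (a : {poly L}) : D :=
  Sub (skew_eval (skew_scal S) (skew_var S) a) (skew_fracs_eval a).

Definition skew_frac_val : {rmorphism D -> S} := GRing.RMorphism.clone _ _ (val : D -> S) _.

Lemma skew_frac_val_inj : injective skew_frac_val.
Proof. exact: val_inj. Qed.

Definition skew_frac_scal (x : L) : D := skew_frac_eval_sub x%:P.

Lemma val_skew_frac_scal x : skew_frac_val (skew_frac_scal x) = skew_scal S x.
Proof. exact: skew_evalC. Qed.

Lemma skew_frac_scal_is_zmod_morphism : zmod_morphism skew_frac_scal.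
Proof. by move=> x y; apply: skew_frac_val_inj; rewrite rmorphB !val_skew_frac_scal rmorphB. Qed.

Lemma skew_frac_scal_is_monoid_morphism : monoid_morphism skew_frac_scal.
Proof.
by split=> [|x y]; apply: skew_frac_val_inj; rewrite ?rmorph1 ?rmorphM !val_skew_frac_scal
  ?rmorph1 ?rmorphM.
Qed.

HB.instance Definition _ := GRing.isZmodMorphism.Build L D skew_frac_scal
  skew_frac_scal_is_zmod_morphism.
HB.instance Definition _ := GRing.isMonoidMorphism.Build L D skew_frac_scal
  skew_frac_scal_is_monoid_morphism.

Definition skew_frac_var : D := skew_frac_eval_sub 'X.

Lemma val_skew_frac_var : skew_frac_val skew_frac_var = skew_var S.
Proof. by rewrite /skew_frac_val /= -(expr1 'X) skew_evalXn expr1. Qed.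

Lemma val_skew_frac_eval (a : {poly L}) :
  skew_frac_val (skew_eval skew_frac_scal skew_frac_var a) =
  skew_eval (skew_scal S) (skew_var S) a.
Proof.
rewrite !skew_eval_coef rmorph_sum; apply: eq_bigr => i _.
by rewrite rmorphM rmorphXn val_skew_frac_scal val_skew_frac_var.
Qed.

Lemma skew_frac_ring_division : is_division_ring D.
Proof.
move=> x x0; have fx : skew_frac (val x) by apply/asboolP; exact: (valP x).
have ux : val x \is a GRing.unit.
  by apply: skew_frac_unit => //; rewrite -(rmorph0 skew_frac_val) (inj_eq skew_frac_val_inj).
have fV : (val x)^-1 \in @skew_fracs L S by apply/asboolP/skew_fracV.
apply/unitrP; exists (Sub (val x)^-1 fV : D); split; apply: skew_frac_val_inj.
  by rewrite rmorphM rmorph1 /= mulVr.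
by rewrite rmorphM rmorph1 /= mulrV.
Qed.

Lemma skew_frac_var_scal x :
  skew_frac_var * skew_frac_scal x = skew_frac_scal (x ^+ 2) * skew_frac_var.
Proof.
apply: skew_frac_val_inj; rewrite !(rmorphM skew_frac_val) !val_skew_frac_scal.
by rewrite val_skew_frac_var skew_comm.
Qed.

Lemma skew_frac_eval_unit (a : {poly L}) : a != 0 ->
  skew_eval skew_frac_scal skew_frac_var a \is a GRing.unit.
Proof.
move=> a0; apply: skew_frac_ring_division; apply: contraNneq a0 => h.
apply/eqP/(@skew_eval_eq0 _ S).
by rewrite -val_skew_frac_eval h rmorph0.
Qed.

(** The ring of fractions is again a [skewRing], so the results above apply to it, now with every
    element a fraction. *)
Definition skew_frac_skewRing : skewRing L := @SkewRing L D skew_frac_scal skew_frac_var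
  (skew_pchar S) (skew_locally_finite S) skew_frac_var_scal skew_frac_eval_unit.

Lemma skew_frac_all (T : skew_frac_skewRing) : skew_frac T.
Proof.
have /asboolP[j [k [a [k0 E]]]] : val (T : D) \in @skew_fracs L S := valP (T : D).
exists j, k, a; split=> //; apply: skew_frac_val_inj.
rewrite val_skew_frac_eval -E /skew_den.
by rewrite !(rmorphM, rmorphB skew_frac_val, rmorphXn, rmorph1) val_skew_frac_var.
Qed.

End SkewFractionRing.

(** * The center of the ring of fractions and the transcendence of [t] *)

Section SkewFractionDivisionRing.
Variables (L : closedFieldType) (S : skewRing L).
Hypothesis all_frac : forall T : S, skew_frac T.
Implicit Types (x : L) (a b : {poly L}) (T U : S).

Local Notation sc := (skew_scal S).
Local Notation t := (skew_var S).
Local Notation op := (skew_eval sc t).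

Lemma skew_division : is_division_ring S.
Proof. by move=> T; exact: skew_frac_unit. Qed.

Lemma skew_eval_scal b x : op b * sc x = op (\poly_(i < size b) (b`_i * x ^+ (2 ^ i))).
Proof.
rewrite skew_eval_coef mulr_suml poly_def raddf_sum /=; apply: eq_bigr => i _.
by rewrite skew_evalZ skew_evalXn -mulrA skew_varX_scal rmorphM mulrA.
Qed.

Lemma skew_center T : center T -> T = 0 \/ T = 1.
Proof.
move=> cT; have [j [k [a [k0 E]]]] := all_frac T.
(* Since [T] commutes with [x], combining [C T x] and [x^(2^j) C T] for the denominator
   [C = t^(j+k) - t^j] cancels the term in [t^j] and leaves a nonzero scalar times [t^(j+k) T]. *)
have ETm : exists m b, t ^+ m * T = op b.
  have [x dx] : exists x : L, x ^+ (2 ^ (j + k)) != x ^+ (2 ^ j).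
    by apply: frobenius_separates (skew_pchar S) _ _ _; rewrite -{2}(addn0 j) eqn_add2l -lt0n.
  pose d := x ^+ (2 ^ (j + k)) - x ^+ (2 ^ j).
  have d0 : d != 0 by rewrite subr_eq0.
  have Ed : sc d * (t ^+ (j + k) * T) = op a * sc x - sc (x ^+ (2 ^ j)) * op a.
    have dE : skew_den S j k = t ^+ (j + k) - t ^+ j by rewrite /skew_den mulrBr mulr1 exprD.
    have dx' : skew_den S j k * sc x =
        sc (x ^+ (2 ^ (j + k))) * t ^+ (j + k) - sc (x ^+ (2 ^ j)) * t ^+ j.
      by rewrite dE mulrBl !skew_varX_scal.
    rewrite -E -(mulrA (skew_den _ _ _) T) cT (mulrA (skew_den _ _ _)) dx'.
    rewrite (mulrA (sc (x ^+ (2 ^ j)))) -mulrBl dE mulrBr opprB addrA subrK.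
    by rewrite -mulrBl -(rmorphB sc) -mulrA.
  exists (j + k)%N.
  exists (d^-1 *: (\poly_(i < size a) (a`_i * x ^+ (2 ^ i)) - x ^+ (2 ^ j) *: a)).
  rewrite skew_evalZ raddfB /= skew_evalZ -skew_eval_scal -Ed (mulrA (sc d^-1)) -(rmorphM sc).
  by rewrite mulVf// rmorph1 mul1r.
have [m [b Eb]] := ETm.
(* Commutation with [x] gives [b_i x^(2^i) = x^(2^m) b_i] for all [x], so [b] is a monomial in [t^m]
   and [T] a scalar. *)
have b0 i : i != m -> b`_i = 0.
  move=> /(frobenius_separates (skew_pchar S))[x dx].
  have : op b * sc x = op (x ^+ (2 ^ m) *: b).
    by rewrite skew_evalZ -Eb -mulrA cT !mulrA skew_varX_scal.
  rewrite skew_eval_scal => /skew_eval_inj /(congr1 (fun p : {poly L} => p`_i)) /=.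
  rewrite coef_poly coefZ; case: ltnP => [_|/(nth_default 0) //].
  move=> /eqP; rewrite mulrC -subr_eq0 -mulrBl mulf_eq0 subr_eq0 (negPf dx).
  by move/eqP.
have bE : b = b`_m *: 'X^m.
  apply/polyP => i; rewrite coefZ coefXn; case: eqVneq => [->|/b0 ->]; first by rewrite mulr1.
  by rewrite mulr0.
have utm : t ^+ m \is a GRing.unit by rewrite unitrX// skew_var_unit.
have TE : T = sc b`_m.
  by apply: (mulIr utm); rewrite cT Eb {1}bE skew_evalZ skew_evalXn.
(* Commutation with [t] makes this scalar equal to its square. *)
have : sc (b`_m ^+ 2) = sc b`_m.
  by apply: (mulIr (skew_var_unit S)); rewrite -skew_comm -TE cT.
move=> /fmorph_inj /eqP; rewrite expr2 -subr_eq0 -{3}[b`_m]mulr1 -mulrBr mulf_eq0.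
rewrite subr_eq0 => /orP[]/eqP h; rewrite TE h ?rmorph0 ?rmorph1; [by left|by right].
Qed.

Lemma skew_not_algebraic : ~ algebraic_over_center S.
Proof.
move=> alg; have [p [p0 [cp pt]]] := alg t.
(* The coefficients of [p] are 0 or 1, so [p] can be read over [L]. *)
pose a : {poly L} := \poly_(i < size p) (p`_i != 0)%:R.
have : op a = 0.
  rewrite -pt horner_coef /a poly_def raddf_sum /=; apply: eq_bigr => i _.
  rewrite skew_evalZ skew_evalXn; congr (_ * _).
  by have [->|->] := skew_center (cp i); rewrite ?eqxx ?oner_neq0 ?rmorph0 ?rmorph1.
move=> /skew_eval_eq0 a0; case/eqP: p0; apply/polyP => i; rewrite coef0.
have := congr1 (fun q : {poly L} => q`_i) a0; rewrite /a coef_poly coef0 /=.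
case: ltnP => [_|/(nth_default 0)//].
by have [->//|_ /eqP] := eqVneq p`_i 0; rewrite oner_eq0.
Qed.

(** * Weak local finiteness *)

Lemma lincomb_sum (K A : set S) n (F : 'I_n -> S) :
  (forall i, lincomb K A (F i)) -> lincomb K A (\sum_i F i).
Proof.
by move=> h; apply: big_ind => //; [exact: lincomb0|move=> *; exact: lincombD].
Qed.

Lemma skew_weakly_locally_finite : weakly_locally_finite S.
Proof.
move=> s; have divS := skew_division.
have [n n0 hn] := skew_frac_common_comm (s := s) (fun T _ => all_frac T).
pose B : set S := centralizer [set t ^+ n].
have BB : is_divsubring B := centralizer_divsubring _ divS.
set E := divsub_gen _.
have EE : is_divsubring E := divsub_gen_divsubring _.
have EB : E `<=` B.
  by move=> T; apply => // U /hn cU y /= ->.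
have [sn hsn] := frobenius_fixed_finite L n0.
(* Powers of [t ^+ n] centralize [B], so only exponents below [n] are needed. *)
pose l := [seq sc x * t ^+ i | x <- sn, i <- iota 0 n].
apply: (@findim_over_own_centerP _ _ l) => // T /EB BT.
(* Spanning over the centralizer of [B] is enough, as that of [E] contains it. *)
apply: (@lincombSl _ (centralizer B)) => [z cz y /EB|]; first exact: cz.
have cTn U : B U -> t ^+ n * U = U * t ^+ n by move=> BU; rewrite BU.
have [|j [k [k0 nj nk]]] := @skew_frac_common _ S [:: T] n n0 (fun U _ => all_frac U).
  by move=> U; rewrite inE => /eqP ->; exact: cTn.
move=> /(_ T (mem_head _ _))[_ [a fa Ea]].
have cB := centralizer_divsubring B divS.
have uden := skew_den_unit S j k0.
have cden : centralizer B (skew_den S j k)^-1.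
  apply: cB.2.2.2; last by apply: contraTneq uden => ->; rewrite unitr0.
  by move=> U BU; apply: (skew_den_comm_dvd nj nk); exact: cTn.
rewrite -(mulKr uden T) Ea skew_eval_coef mulr_sumr; apply: lincomb_sum => i.
rewrite {2}(divn_eq i n) exprD.
have c : sc a`_i * t ^+ (i %/ n * n) = t ^+ (i %/ n * n) * sc a`_i.
  by rewrite skew_varX_scal (frobenius_iter_fixed _ (fa i))// dvdn_mull.
rewrite (mulrA (sc _)) c -(mulrA (t ^+ _)) mulrA; apply: lincomb_scale.
  apply: cB.2.2.1 => // U BU; rewrite mulnC exprM.
  by apply/commr_sym/commrX/esym; exact: cTn.
apply: allpairs_f; first exact: hsn.
by rewrite mem_iota ltn_mod.
Qed.

(** * Linear growth of the powers of a finite dimensional subspace *)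

Lemma skew_span_common (s : seq S) : exists C n d, [/\ C \is a GRing.unit, (0 < n)%N &
  forall v, spanF s v -> C * v = v * C /\
    exists a, [/\ frobenius_fixed n a, (size a <= d)%N & C * v = op a]].
Proof.
have [n n0 hn] := skew_frac_common_comm (s := s) (fun T _ => all_frac T).
have [j [k [k0 _ _ hs]]] := skew_frac_common n0 (fun T _ => all_frac T) hn.
have [d hd] : exists d, forall v, v \in s ->
    exists a, [/\ frobenius_fixed n a, (size a <= d)%N & skew_den S j k * v = op a].
  elim: s {hn} hs => [|v s IH] hs; first by exists 0%N.
  have [d hd] : exists d, forall v, v \in s ->
      exists a, [/\ frobenius_fixed n a, (size a <= d)%N & skew_den S j k * v = op a].
    by apply: IH => u us; apply: hs; rewrite inE us orbT.
  have [_ [a fa Ea]] := hs v (mem_head _ _).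
  exists (maxn (size a) d) => u; rewrite inE => /orP[/eqP ->|/hd[b [fb sb Eb]]].
    by exists a; split=> //; exact: leq_maxl.
  by exists b; split=> //; exact: leq_trans sb (leq_maxr _ _).
exists (skew_den S j k), n, d; split=> //; first exact: skew_den_unit.
have f0 : frobenius_fixed n (0 : {poly L}) by move=> i; rewrite coef0 frobenius0.
apply: lincomb_sub => [|u v [cu [a [fa sa Ea]]] [cv [b [fb sb Eb]]]|z v].
- by rewrite !mulr0 mul0r; split=> //; exists 0; rewrite size_poly0 raddf0.
- rewrite mulrDr mulrDl cu cv; split=> //; exists (a + b); split.
  + by move=> i; rewrite coefD (frobeniusD (skew_pchar S)) fa fb.
  + by apply: leq_trans (size_polyD _ _) _; rewrite geq_max sa sb.
  + by rewrite raddfD /= -Ea -Eb cu cv.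
(* Central scalars are 0 or 1, so they keep the bounds on numerators. *)
move=> /skew_center[]-> /= vs; rewrite ?mul0r ?mul1r.
  by rewrite mulr0; split=> //; exists 0; rewrite size_poly0 raddf0.
by split; [exact: (hs v vs).1|exact: hd].
Qed.

Lemma skew_powV_dim (V : set S) : (exists s, spanF s = V) ->
  exists2 A, (0 < A)%N & forall r, (0 < r)%N ->
    exists2 s, (size s <= A * r)%N & spanF s = powV V r.
Proof.
move=> [s <-]; have [C [n [d [uC n0 hC]]]] := skew_span_common s.
have divS := skew_division; have cS := center_divsubring divS.
have [sn hsn] := frobenius_fixed_finite L n0.
(* The list [l] below has [size sn * (r * d + 1)] entries, and [r * d + 1 <= r * (d + 1)] as
   [r > 0]; the successor of [size sn] keeps the constant positive. *)
exists ((size sn).+1 * d.+1)%N => // r r0.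
pose l := [seq (C ^+ r)^-1 * (sc x * t ^+ i) | x <- sn, i <- iota 0 (r * d).+1].
have prodC (xs : seq S) : (forall y, y \in xs -> spanF s y) ->
    exists a, [/\ frobenius_fixed n a, (size a <= (size xs * d).+1)%N &
      C ^+ size xs * \prod_(y <- xs) y = op a].
  elim: xs => [|y xs IH] hxs.
    exists 1; split; last by rewrite big_nil mulr1 -(expr0 'X) skew_evalXn.
      by move=> i; rewrite coef1; case: eqP => _; rewrite ?expr1n ?frobenius0.
    by rewrite size_poly1.
  have [|b [fb sb Eb]] := IH; first by move=> z zs; apply: hxs; rewrite inE zs orbT.
  have [cy [a [fa sa Ea]]] := hC y (hxs y (mem_head _ _)).
  have [p [Ep sp fp]] := skew_eval_mul S a b.
  exists p; split; first exact: fp.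
    by apply: leq_trans sp _; rewrite /= mulSn -addnS leq_add.
  rewrite Ep -Ea -Eb big_cons /= exprS -!mulrA; congr (_ * _).
  rewrite !mulrA; congr (_ * _).
  by apply/commr_sym/commrX/esym.
have sub : powV (spanF s) r `<=` spanF l.
  have H : powV (spanF s) r `<=` [set T | exists a,
      [/\ frobenius_fixed n a, (size a <= (r * d).+1)%N & C ^+ r * T = op a]].
    apply: lincomb_sub => [|u v [a [fa sa Ea]] [b [fb sb Eb]]|z v].
    - exists 0; rewrite mulr0 size_poly0 raddf0; split=> // i.
      by rewrite coef0 frobenius0.
    - exists (a + b); split.
      + by move=> i; rewrite coefD (frobeniusD (skew_pchar S)) fa fb.
      + by apply: leq_trans (size_polyD _ _) _; rewrite geq_max sa sb.
      + by rewrite mulrDr raddfD /= -Ea -Eb.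
    move=> /skew_center[]-> /= [xs [<- [hxs ->]]].
      exists 0; rewrite mul0r mulr0 size_poly0 raddf0; split=> // i.
      by rewrite coef0 frobenius0.
    by rewrite mul1r; exact: prodC.
  move=> T /H[a [fa sa Ea]].
  have uCr : C ^+ r \is a GRing.unit by rewrite unitrX.
  rewrite -(mulKr uCr T) Ea skew_eval_coef mulr_sumr; apply: lincomb_sum => i.
  apply: lincomb_mem; first exact: cS.1.
  apply/allpairsP; exists (a`_i, nat_of_ord i); split=> //; first exact: (hsn _ (fa i)).
  by rewrite mem_iota add0n; exact: leq_trans (ltn_ord i) sa.
(* [dimF] asks for lists spanning exactly [powV V r], not merely a space containing it. *)
have [|||s' ss' Es'] := span_subspace divS cS _ _ _ sub.
- exact: lincomb0.
- by move=> *; exact: lincombB.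
- by move=> *; exact: lincombZ.
exists s' => //; apply: leq_trans ss' _; rewrite size_allpairs size_iota.
by rewrite -mulnA leq_mul// mulSn addnC mulnC -addn1 leq_add2l.
Qed.

Lemma skew_powV_span_var r s : spanF s = powV (spanF [:: 1; t]) r -> (r < size s)%N.
Proof.
have divS := skew_division; have cS := center_divsubring divS => Es.
(* Highest power first: [indep] compares each entry with those after it. *)
pose e m := rev (mkseq (fun i => t ^+ i) m).
have eS m : e m.+1 = t ^+ m :: e m by rewrite /e mkseqS rev_rcons.
have -> : r.+1 = size (e r.+1) by rewrite size_rev size_mkseq.
apply: (indep_size divS cS) => [|T]; last first.
  rewrite /e /= mem_rev => /mapP[i]; rewrite mem_iota add0n ltnS /= => ir ->.
  rewrite -/(spanF s) Es; apply: lincomb_mem; first exact: cS.1.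
  (* Padding by 1 makes [t ^+ i] a product of exactly [r] factors. *)
  exists (nseq i t ++ nseq (r - i) 1); split.
    by rewrite size_cat !size_nseq subnKC.
  split=> [y|]; last by rewrite big_cat /= !big_nseq !iter_mulr_1 expr1n mulr1.
  move=> yt; apply: lincomb_mem; first exact: cS.1.
  move: yt; rewrite mem_cat !mem_nseq /= !inE.
  by move=> /orP[]/andP[_ ->]; rewrite ?orbT.
elim: r.+1 => [//|m IH]; rewrite eS; split=> // h.
have [b sb Eb] : exists2 b : {poly L}, (size b <= m)%N & t ^+ m = op b.
  move: {IH} (t ^+ m) h; apply: lincomb_sub => [|u v [a sa ->] [b sb ->]|z v].
  - by exists 0; rewrite ?size_poly0 ?raddf0.
  - exists (a + b); last by rewrite raddfD.
    by apply: leq_trans (size_polyD _ _) _; rewrite geq_max sa sb.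
  move=> /skew_center[]->; first by rewrite mul0r; exists 0; rewrite ?size_poly0 ?raddf0.
  rewrite /= /e mem_rev => /mapP[i]; rewrite mem_iota add0n /= => im ->.
  by exists 'X^i; rewrite ?size_polyXn// mul1r skew_evalXn.
move: Eb; rewrite -(skew_evalXn sc t) => /skew_eval_inj Eb.
by move: sb; rewrite -Eb size_polyXn ltnn.
Qed.

End SkewFractionDivisionRing.

(** * From linear growth to dimension one *)

Section GelfandKirillovOne.
Variables (D : unitRingType) (R : realType).
Implicit Types (V W : set D) (s : seq D).
Local Open Scope ereal_scope.

Lemma dimF_le s W : spanF s = W -> dimF R W <= ((size s)%:R)%:E.
Proof. by move=> sW; apply: ereal_inf_lbound; exists s. Qed.

Lemma dimF_ge n W : (forall s, spanF s = W -> (n <= size s)%N) -> (n%:R)%:E <= dimF R W.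
Proof.
by move=> h; apply: le_ereal_inf_tmp => _ [s /h sn <-]; rewrite lee_fin ler_nat.
Qed.

(** Squeezed between two naturals, [dimF] is finite, so [fine] does not return its default value. *)
Lemma fine_dimF_bounds m n s W : spanF s = W -> (size s <= n)%N ->
  (forall s', spanF s' = W -> (m <= size s')%N) ->
  (m%:R <= fine (dimF R W) <= n%:R)%R.
Proof.
move=> sW sn mW; have h1 := dimF_ge mW; have h2 := dimF_le sW.
have h3 : dimF R W <= (n%:R)%:E by apply: le_trans h2 _; rewrite lee_fin ler_nat.
by move: h1 h3; case: (dimF R W) => //= x; rewrite !lee_fin => -> ->.
Qed.

Lemma growth_le1 V A : (0 < A)%N ->
  (forall r, (0 < r)%N -> exists2 s, (size s <= A * r)%N & spanF s = powV V r) ->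
  growth R V <= 1.
Proof.
move=> A0 hA; apply/lee_addgt0Pr => e e0.
have lnA : (0 <= ln (A%:R : R))%R by rewrite ln_ge0// ler1n.
(* For [r >= N] the quotient [ln A / ln r] is at most [e]; the offset 2 also ensures [ln r > 0]. *)
pose N := (Num.truncn (expR (ln (A%:R : R) / e))).+2.
apply: ge_ereal_inf; exists (ereal_sup [set
    ((ln (fine (dimF R (powV V r))) / ln (r%:R))%R)%:E | r in [set r | (N <= r)%N]]).
  by exists [set r | (N <= r)%N] => //; exists N.
apply: ge_ereal_sup => _ [r /= Nr <-]; rewrite lee_fin.
have r1 : (1 < r)%N by apply: leq_trans Nr.
have r0 : (0 < r)%N by apply: ltnW.
have lnr : (0 < ln (r%:R : R))%R by rewrite ln_gt0// ltr1n.
rewrite ler_pdivrMr// mulrDl mul1r.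
have [s ss Es] := hA r r0.
have /andP[x0 xA] := fine_dimF_bounds Es ss (fun s' _ => leq0n (size s')).
have Ar0 : (0 < (A * r)%:R :> R)%R by rewrite ltr0n muln_gt0 A0.
apply: (@le_trans _ _ (ln (A * r)%:R)).
  (* [ln] is 0 at nonpositive arguments, which covers dimension 0. *)
  have [x00|x00] := leP (fine (dimF R (powV V r))) 0%R.
    by rewrite (ln0 x00) ln_ge0// ler1n muln_gt0 A0.
  by rewrite ler_ln.
rewrite natrM lnM ?posrE ?ltr0n// addrC lerD2l -ler_pdivrMl//.
rewrite mulrC -ler_expR lnK ?posrE ?ltr0n//.
apply: le_trans (ltW (truncnS_gt _)) _; rewrite ler_nat.
exact: leq_trans Nr.
Qed.

Lemma growth_ge1 V : (exists s, spanF s = V) ->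
  (forall r, (0 < r)%N -> exists s, spanF s = powV V r) ->
  (forall r s, spanF s = powV V r -> (r < size s)%N) -> 1 <= growth R V.
Proof.
move=> sV spV h; apply: le_ereal_inf_tmp => _ [P [N _ NP] <-].
(* Each tail contains such an [r], where the dimension exceeds [r] and [ln r > 0]. *)
apply: le_ereal_sup_tmp; pose r := N.+2.
exists ((ln (fine (dimF R (powV V r))) / ln (r%:R))%R)%:E.
  by exists r => //; apply: NP => /=; rewrite /r 2?ltnW.
have [s Es] := spV r isT.
have lnr : (0 < ln (r%:R : R))%R by rewrite ln_gt0// ltr1n.
have /andP[x1 _] := fine_dimF_bounds Es (leqnn _) (h r).
rewrite lee_fin ler_pdivlMr// mul1r ler_ln ?posrE ?ltr0n//.
  by apply: le_trans x1; rewrite ler_nat.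
by apply: lt_le_trans x1; rewrite ltr0n.
Qed.

Lemma GKdimF_eq1 V0 : (exists s, spanF s = V0) -> V0 1%R ->
  (forall V, (exists s, spanF s = V) -> exists2 A, (0 < A)%N &
     forall r, (0 < r)%N -> exists2 s, (size s <= A * r)%N & spanF s = powV V r) ->
  (forall r s, spanF s = powV V0 r -> (r < size s)%N) -> GKdimF D R = 1.
Proof.
move=> sV0 V01 hV hV0; apply/eqP; rewrite eq_le; apply/andP; split.
  by apply: ge_ereal_sup => _ [V [sV _] <-]; have [A A0 hA] := hV V sV; exact: growth_le1 A0 hA.
apply: le_ereal_sup_tmp; exists (growth R V0); first by exists V0.
have [A _ hA] := hV V0 sV0; apply: growth_ge1 => // r r0.
by have [s _ Es] := hA r r0; exists s.
Qed.

End GelfandKirillovOne.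

Local Open Scope quotient_scope.

(** * Sequences modulo those of finite range *)

Section SequencesModuloFiniteRange.
Variable L : closedFieldType.

Definition finite_range : {pred nat -> L} :=
  [pred m | `[< exists s : seq L, forall i, m i \in s >]].

Lemma finite_range_zmod_closed : zmod_closed finite_range.
Proof.
split; first by apply/asboolP; exists [:: 0] => i; rewrite inE.
move=> u v /asboolP[s hs] /asboolP[r hr]; apply/asboolP.
by exists [seq x - y | x <- s, y <- r] => i; exact: allpairs_f.
Qed.

HB.instance Definition _ := GRing.isZmodClosed.Build (nat -> L) finite_range
  finite_range_zmod_closed.

(** Additive maps of [L] with finite kernel become injective here: a sequence has finite range as
    soon as its image under such a map has. *)
Definition seq_quot := Quotient.quot finite_range.
HB.instance Definition _ := GRing.Zmodule.on seq_quot.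

Definition seq_pi (m : nat -> L) : seq_quot := \pi m.

Lemma seq_piP q : exists m, q = seq_pi m.
Proof. by exists (repr q); rewrite /seq_pi reprK. Qed.

Lemma seq_pi_is_zmod_morphism : zmod_morphism seq_pi.
Proof. by move=> u v; rewrite /seq_pi raddfB. Qed.

HB.instance Definition _ := GRing.isZmodMorphism.Build (nat -> L) seq_quot seq_pi
  seq_pi_is_zmod_morphism.

Lemma seq_pi_eq u v : seq_pi u = seq_pi v <-> u - v \in finite_range.
Proof. by rewrite Quotient.idealrBE; split=> [/eqP|/eqP]. Qed.

Lemma closed_field_fresh (s : seq L) : exists x : L, x \notin s.
Proof.
(* A root of [p * 'X + 1] is not a root of [p]; the factor ['X] keeps the degree positive when [s]
   is empty. *)
pose p : {poly L} := \prod_(z <- s) ('X - z%:P).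
have [s0|s0] := eqVneq (size (p * 'X + 1%:P)) 1.
  by exfalso; move: s0; rewrite size_MXaddC oner_eq0 andbF => -[] /eqP;
    rewrite size_prod_XsubC.
have /closed_rootP[x rx] := s0; exists x; apply/negP => xs.
suff : (p * 'X + 1%:P).[x] = 1 by move=> h; move: rx; rewrite /root h oner_eq0.
have /eqP px : root p x by rewrite root_prod_XsubC.
by rewrite !hornerE px mul0r add0r.
Qed.

Lemma seq_quot_neq0 : exists q : seq_quot, q != 0.
Proof.
have [pick hpick] := choice closed_field_fresh.
(* [g n] lists the first [n] picks, each new to the earlier ones, so the picks form a sequence of
   infinite range. *)
pose g := fix g n := if n is n'.+1 then pick (g n') :: g n' else [::].
have pickg i j : (i < j)%N -> pick (g i) \in g j.
  elim: j => // j IH; rewrite ltnS leq_eqVlt inE => /orP[/eqP ->|/IH ->].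
    by rewrite eqxx.
  by rewrite orbT.
exists (seq_pi (fun n => pick (g n))); apply/eqP; rewrite -(raddf0 seq_pi) => /seq_pi_eq.
rewrite subr0 => /asboolP[s hs].
have [i [j [ij fij]]] := pigeonhole_nat hs.
by have := pickg _ _ ij; rewrite fij (negPf (hpick _)).
Qed.

(** * The ring of additive endomorphisms of the quotient *)

Definition is_endo : {pred seq_quot -> seq_quot} := [pred f | `[< zmod_morphism f >]].

Lemma is_endo_zmod_closed : zmod_closed is_endo.
Proof.
split; first by apply/asboolP => x y; rewrite /= subrr.
move=> f g /asboolP fB /asboolP gB; apply/asboolP => x y.
by rewrite !fctE fB gB !opprD !opprK addrACA.
Qed.

HB.instance Definition _ := GRing.isZmodClosed.Build (seq_quot -> seq_quot) is_endo
  is_endo_zmod_closed.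

Definition endo := {f : seq_quot -> seq_quot | f \in is_endo}.
HB.instance Definition _ := SubChoice.on endo.
HB.instance Definition _ := [SubChoice_isSubZmodule of endo by <:].

Definition endo_fun (f : endo) : seq_quot -> seq_quot := val f.
Coercion endo_fun : endo >-> Funclass.

Lemma endoP (f g : endo) : f =1 g -> f = g.
Proof. by move=> fg; apply: val_inj; apply/funext. Qed.

Lemma endo_is_zmod_morphism (f : endo) : zmod_morphism f.
Proof. exact/asboolP/(valP f). Qed.

HB.instance Definition _ (f : endo) := GRing.isZmodMorphism.Build seq_quot seq_quot f
  (@endo_is_zmod_morphism f).

Definition Endo (f : seq_quot -> seq_quot) (fB : zmod_morphism f) : endo :=
  Sub f (asboolT fB : f \in is_endo).

Definition endo1 : endo := @Endo id (fun x y => erefl).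

Definition endo_mul (f g : endo) : endo :=
  @Endo (fun q => f (g q)) (fun x y => etrans (congr1 f (raddfB g x y)) (raddfB f _ _)).

Lemma endo_mulA : associative endo_mul. Proof. by move=> f g h; exact: endoP. Qed.
Lemma endo_mul1l : left_id endo1 endo_mul. Proof. by move=> f; exact: endoP. Qed.
Lemma endo_mul1r : right_id endo1 endo_mul. Proof. by move=> f; exact: endoP. Qed.
Lemma endo_mulDl : left_distributive endo_mul +%R.
Proof. by move=> f g h; exact: endoP. Qed.
Lemma endo_mulDr : right_distributive endo_mul +%R.
Proof. by move=> f g h; apply: endoP => q; exact: (raddfD f). Qed.
Lemma endo1_neq0 : endo1 != 0.
Proof.
have [q q0] := seq_quot_neq0; apply: contraNneq q0 => h.
by rewrite -[q]/(endo1 q) h.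
Qed.

HB.instance Definition _ := GRing.Zmodule_isNzRing.Build endo
  endo_mulA endo_mul1l endo_mul1r endo_mulDl endo_mulDr endo1_neq0.

Definition endo_invertible (f : endo) : Prop := exists g : endo, g * f = 1 /\ f * g = 1.

Definition endo_unit : {pred endo} := [pred f | `[< endo_invertible f >]].

Definition endo_inv (f : endo) : endo :=
  if pselect (endo_invertible f) is left h then sval (cid h) else f.

Lemma endo_mulVr : {in endo_unit, left_inverse 1 endo_inv *%R}.
Proof.
move=> f /asboolP hf; rewrite /endo_inv; case: pselect => // h.
by case: (cid h) => g [].
Qed.

Lemma endo_divrr : {in endo_unit, right_inverse 1 endo_inv *%R}.
Proof.
move=> f /asboolP hf; rewrite /endo_inv; case: pselect => // h.
by case: (cid h) => g [].
Qed.

Lemma endo_unitP f g : g * f = 1 /\ f * g = 1 -> f \in endo_unit.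
Proof. by move=> h; apply/asboolP; exists g. Qed.

Lemma endo_inv_out : {in [predC endo_unit], endo_inv =1 id}.
Proof.
move=> f; rewrite inE /= => /asboolP nf; by rewrite /endo_inv; case: pselect.
Qed.

HB.instance Definition _ := GRing.NzRing_hasMulInverse.Build endo
  endo_mulVr endo_divrr endo_unitP endo_inv_out.

Lemma endo_bijective_unit (f : endo) :
  injective f -> (forall q, exists r, f r = q) -> f \is a GRing.unit.
Proof.
move=> finj /choice[g fg].
have gB : zmod_morphism g.
  by move=> x y; apply: (finj); rewrite (endo_is_zmod_morphism f) !fg.
by apply/unitrP; exists (Endo gB); split; apply: endoP => q;
  [apply: finj; exact: (fg (f q))|exact: (fg q)].
Qed.

(** * The action of skew polynomials by linearized polynomials *)

Lemma seq_pi_comp (h : L -> L) u v : zmod_morphism h ->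
  seq_pi u = seq_pi v -> seq_pi (h \o u) = seq_pi (h \o v).
Proof.
move=> hB /seq_pi_eq/asboolP[s hs]; apply/seq_pi_eq/asboolP.
exists (map h s) => i; have := map_f h (hs i).
by rewrite !fctE hB.
Qed.

(** For additive [h] the choice of representative does not matter, since [h] preserves finite
    range. *)
Definition seq_lift (h : L -> L) (q : seq_quot) : seq_quot := seq_pi (h \o repr q).

Lemma seq_liftE h m : zmod_morphism h -> seq_lift h (seq_pi m) = seq_pi (h \o m).
Proof. by move=> hB; apply: seq_pi_comp => //; rewrite /seq_pi reprK. Qed.

Lemma seq_lift_is_zmod_morphism h : zmod_morphism h -> zmod_morphism (seq_lift h).
Proof.
move=> hB p q; have [u ->] := seq_piP p; have [v ->] := seq_piP q.
rewrite -raddfB !seq_liftE// -raddfB /=; congr seq_pi; apply/funext => i.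
by rewrite !fctE hB.
Qed.

Definition endo_lift h (hB : zmod_morphism h) : endo := Endo (seq_lift_is_zmod_morphism hB).

Lemma mul_is_zmod_morphism (x : L) : zmod_morphism ( *%R x).
Proof. by move=> y z; rewrite mulrBr. Qed.

Definition endo_scal (x : L) : endo := endo_lift (mul_is_zmod_morphism x).

Lemma endo_scalE x m : endo_scal x (seq_pi m) = seq_pi (fun i => x * m i).
Proof. exact: seq_liftE (mul_is_zmod_morphism x). Qed.

Lemma endo_scal_is_zmod_morphism : zmod_morphism endo_scal.
Proof.
move=> x y; apply: endoP => q; have [m ->] := seq_piP q.
rewrite -[RHS]/(endo_scal x _ - endo_scal y _) !endo_scalE -raddfB /=.
by congr seq_pi; apply/funext => i; rewrite !fctE mulrBl.
Qed.

Lemma endo_scal_is_monoid_morphism : monoid_morphism endo_scal.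
Proof.
split=> [|x y]; apply: endoP => q; have [m ->] := seq_piP q.
  by rewrite endo_scalE; congr seq_pi; apply/funext => i; rewrite mul1r.
rewrite -[RHS]/(endo_scal x (endo_scal y _)) !endo_scalE.
by congr seq_pi; apply/funext => i; rewrite mulrA.
Qed.

HB.instance Definition _ := GRing.isZmodMorphism.Build L endo endo_scal
  endo_scal_is_zmod_morphism.
HB.instance Definition _ := GRing.isMonoidMorphism.Build L endo endo_scal
  endo_scal_is_monoid_morphism.

Hypothesis char2 : 2%N \in [pchar L].

Lemma square_is_zmod_morphism : zmod_morphism (fun y : L => y ^+ 2).
Proof. by move=> x y; exact: (frobeniusB char2 1). Qed.

Definition endo_square : endo := endo_lift square_is_zmod_morphism.

Lemma endo_squareX n m : (endo_square ^+ n : endo) (seq_pi m) = seq_pi (fun i => m i ^+ (2 ^ n)).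
Proof.
elim: n m => [|n IH] m.
  by rewrite -[LHS]/(seq_pi m); congr seq_pi; apply/funext => i; rewrite expr1.
rewrite exprSr -[LHS]/((endo_square ^+ n : endo) (endo_square _)).
rewrite [endo_square _](seq_liftE _ square_is_zmod_morphism) IH.
by congr seq_pi; apply/funext => i /=; rewrite -exprM expnS.
Qed.

Lemma endo_square_scal x : endo_square * endo_scal x = endo_scal (x ^+ 2) * endo_square.
Proof.
apply: endoP => q; have [m ->] := seq_piP q.
rewrite -[LHS]/(endo_square (endo_scal x _)) -[RHS]/(endo_scal _ (endo_square _)).
rewrite endo_scalE -[endo_square]expr1 !endo_squareX endo_scalE.
by congr seq_pi; apply/funext => i; rewrite exprMn.
Qed.

(** The map of [L] given by [a] when [t] acts as squaring. *)
Definition linearized (a : {poly L}) : {poly L} := \sum_(i < size a) a`_i *: 'X^(2 ^ i).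

Lemma linearized_fiber (a : {poly L}) (c : L) : a != 0 ->
  (exists x, (linearized a).[x] = c) /\
  exists s : seq L, forall x, (linearized a).[x] = c -> x \in s.
Proof.
move=> a0; pose p := linearized a - c%:P.
have sa : (0 < size a)%N by rewrite size_poly_gt0.
(* This exponent is at least 1, so the constant [c] does not affect the coefficient and [p] is not
   constant. *)
have pc : p`_(2 ^ (size a).-1) != 0.
  rewrite coefB coefC expn_eq0 /= subr0 coef_sum.
  have lt : ((size a).-1 < size a)%N by rewrite prednK.
  rewrite (bigD1 (Ordinal lt)) //= coefZ coefXn eqxx mulr1 big1 ?addr0 ?lead_coef_eq0//.
  move=> i /negP ni; rewrite coefZ coefXn eqn_exp2l//; case: eqP => [h|]; last by rewrite mulr0.
  by case: ni; apply/eqP/val_inj.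
have sp : (1 < size p)%N.
  apply: leq_ltn_trans (expn_gt0 2 (size a).-1) _; rewrite ltnNge.
  by apply: contra pc => /leq_sizeP ->.
have rootE x : root p x = ((linearized a).[x] == c) by rewrite /root !hornerE subr_eq0.
split.
  have /closed_rootP[x] : size p != 1 by rewrite neq_ltn sp orbT.
  by rewrite rootE => /eqP xc; exists x.
have [|s hs] := @closed_field_roots _ p; first by rewrite -size_poly_gt0 ltnW.
by exists s => x xc; apply: hs; rewrite rootE xc.
Qed.

Lemma endo_evalE (a : {poly L}) m :
  (skew_eval endo_scal endo_square a : endo) (seq_pi m) = seq_pi (fun i => (linearized a).[m i]).
Proof.
rewrite skew_eval_coef.
rewrite (big_morph (fun f : endo => f (seq_pi m)) (id1 := 0) (op1 := +%R))//.
transitivity (\sum_(k < size a) seq_pi (fun i => a`_k * m i ^+ (2 ^ k))).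
  apply: eq_bigr => k _.
  by rewrite -[LHS]/(endo_scal _ ((endo_square ^+ k : endo) _)) endo_squareX endo_scalE.
rewrite -raddf_sum; congr seq_pi; apply/funext => i; rewrite fct_sumE horner_sum.
by apply: eq_bigr => k _; rewrite !hornerE.
Qed.

Lemma endo_eval_unit (a : {poly L}) : a != 0 ->
  skew_eval endo_scal endo_square a \is a GRing.unit.
Proof.
move=> a0; apply: endo_bijective_unit => [p q|q].
  have [u ->] := seq_piP p; have [v ->] := seq_piP q => /eqP.
  rewrite -subr_eq0 -!raddfB /= endo_evalE -(raddf0 seq_pi) => /eqP/seq_pi_eq.
  rewrite subr0 => /asboolP[s hs]; apply/seq_pi_eq/asboolP.
  have /choice[r hr] : forall c : L, exists s : seq L, forall x,
    (linearized a).[x] = c -> x \in s by move=> c; have [] := linearized_fiber c a0.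
  (* A finite union of finite fibers gives injectivity; solving termwise gives surjectivity. *)
  exists (flatten (map r s)) => i; apply/flatten_mapP.
  by exists (linearized a).[(u - v) i]; [exact: hs|exact: hr].
have [m ->] := seq_piP q.
have /choice[r hr] : forall i : nat, exists x, (linearized a).[x] = m i.
  by move=> i; have [] := linearized_fiber (m i) a0.
by exists (seq_pi r); rewrite endo_evalE; congr seq_pi; apply/funext.
Qed.

End SequencesModuloFiniteRange.

(** * Algebraic closure of the field of two elements *)

Lemma integral_pchar2_locally_finite (L : closedFieldType) (f : {rmorphism 'F_2 -> L}) :
  integralRange f -> forall x : L, exists2 n, (0 < n)%N & x ^+ (2 ^ n) = x.
Proof.
move=> intL x; have [p pmon px] := intL x.
have char2 : 2%N \in [pchar L] by rewrite (fmorph_pchar f) pchar_Fp.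
have p0 := monic_neq0 pmon.
(* Reduced modulo [p], the powers of ['X] leave finitely many remainders over ['F_2]. *)
have [s hs] : exists s : seq L, forall i, x ^+ (2 ^ i) \in s.
  have [s hs] := @poly_coef_finite 'F_2 (enum 'F_2) (size p).
  exists [seq (map_poly f q).[x] | q <- s] => i.
  apply/mapP; exists ('X^(2 ^ i) %% p).
    by apply: hs => [k|]; [rewrite mem_enum|rewrite ltnW// ltn_modp].
  rewrite -(hornerXn x (2 ^ i)) -(map_polyXn f) {1}(divp_eq 'X^(2 ^ i) p).
  by rewrite rmorphD rmorphM /= hornerD hornerM (eqP px) mulr0 add0r.
have [i [j [ij /eqP E]]] := pigeonhole_nat hs.
exists (j - i)%N; first by rewrite subn_gt0.
(* Injectivity of the Frobenius map cancels the exponent [2 ^ i]. *)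
apply: (frobenius_inj char2 (n := i)); rewrite -frobenius_iter subnK ?(eqP E)//.
exact: ltnW.
Qed.

Lemma pchar2_closed_field_exists : exists L : closedFieldType,
  2%N \in [pchar L] /\ forall x : L, exists2 n, (0 < n)%N & x ^+ (2 ^ n) = x.
Proof.
have [K [f intK]] := countable_algebraic_closure 'F_2.
exists K; split; last exact: integral_pchar2_locally_finite intK.
by rewrite (fmorph_pchar f) pchar_Fp.
Qed.

Theorem theorem4p1 :
  exists D : unitRingType,
    is_division_ring D /\ weakly_locally_finite D /\
    GKdimF D Rdefinitions.R = 1%E /\ ~ algebraic_over_center D.
Proof.
have [L [char2 lfL]] := pchar2_closed_field_exists.
(* [S] is the endomorphism ring; the division ring is cut out of it as the fractions. *)
pose S := SkewRing char2 lfL (endo_square_scal char2) (endo_eval_unit char2).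
have all_frac := @skew_frac_all L S.
have divD := skew_division all_frac.
exists (skew_frac_skewRing S); split=> //; split; first exact: skew_weakly_locally_finite.
split; last exact: skew_not_algebraic.
apply: (@GKdimF_eq1 _ _ (spanF [:: 1; skew_var (skew_frac_skewRing S)])).
- by eexists.
- by apply: lincomb_mem; [exact: (center_divsubring divD).1|rewrite /= mem_head].
- exact: skew_powV_dim.
- exact: skew_powV_span_var.
Qed.
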